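(* Let $\mathcal{R}$ be an injective von Neumann algebra on a Hilbert space $H$, let $G$ be a discrete group acting on $\mathcal{R}$ by $*$-automorphisms $\alpha_g$, and let $\pi$ be a completely positive conditional expectation of $B(H)$ onto $\mathcal{R}$. Let $\xi=(k_g)_{g\in G}$ be a unit vector in $\ell_2(G)$. Then the mapping $\sigma_\xi$ of $B(H\otimes\ell_2(G))$ to $\mathcal{L}(\mathcal{R},\alpha,G)$ defined by $$\sigma_\xi(x):=\sum_{g,h\in G}L_{gh^{-1}}\Psi\big(\alpha_h(\pi(x_{(g,h)}))\big)\overline{k_g}\,k_h$$ is unital, completely positive and $\Psi(\mathcal{R})$-bimodular, and any operator of the form $L_g\Psi(r)$ with $g\in G$, $r\in\mathcal{R}$ is an eigenvector of $\sigma_\xi$ with eigenvalue $\langle\lambda_g\xi,\xi\rangle$, i.e. $\sigma_\xi(L_g\Psi(r))=\langle\lambda_g\xi,\xi\rangle L_g\Psi(r)$.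
   Context: Let $(\delta_g)_{g\in G}$ be the canonical orthonormal basis of $\ell_2(G)$, $\lambda_g$ the left translation unitaries, $\lambda_g\delta_h=\delta_{gh}$, and $(e_{(g,h)})_{g,h\in G}$ the canonical matrix units of $B(\ell_2(G))$. Inner products are linear in the first variable. Define $L_g:=I_H\otimes\lambda_g$ and the normal faithful representation $\Psi(r):=\sum_{g\in G}\alpha_{g^{-1}}(r)\otimes e_{(g,g)}$ of $\mathcal{R}$ on $H\otimes\ell_2(G)$. The crossed product von Neumann algebra $\mathcal{L}(\mathcal{R},\alpha,G)$ is the ultra-weak closure of $\mathrm{span}\{L_g\Psi(r): g\in G, r\in\mathcal{R}\}$ in $B(H\otimes\ell_2(G))$. A bounded operator $x$ on $H\otimes\ell_2(G)$ is written as a block matrix $x=\sum_{g,h}x_{(g,h)}\otimes e_{(g,h)}$ with $x_{(g,h)}\in B(H)$. The sum defining $\sigma_\xi(x)$ is understood entrywise as a block matrix indexed by $G\times G$ with entries in $B(H)$: its $(i,j)$ entry is the absolutely norm-convergent sum $\sum_{h\in G}\overline{k_{ij^{-1}h}}\,k_h\,\alpha_{j^{-1}h}\big(\pi(x_{(ij^{-1}h,h)})\big)$. $\Psi(\mathcal{R})$-bimodular means $\sigma_\xi(\Psi(r)x\Psi(s))=\Psi(r)\sigma_\xi(x)\Psi(s)$ for $r,s\in\mathcal{R}$. *)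

(* Defs.v *)
From HB Require Import structures.
From mathcomp Require Import all_boot all_order all_algebra finmap.
From mathcomp Require Import boolp classical_sets functions reals topology normedtype.
From mathcomp Require Import sesquilinear complex ring.
Set Implicit Arguments.
Unset Strict Implicit.
Unset Printing Implicit Defensive.

Import Order.TTheory GRing.Theory Num.Theory.
Import numFieldNormedType.Exports.
Local Open Scope classical_set_scope.
Local Open Scope ring_scope.

Section complex_complete.
Local Open Scope complex_scope.

Lemma complex_complete (R : realType) (F : set_system R[i]^o) :
  ProperFilter F -> cauchy F -> cvg F.
Proof.
move=> FF /cauchy_ballP Fc.
have ReB (x y : R[i]) : complex.Re (x - y) = complex.Re x - complex.Re y by case: x; case: y.
have ImB (x y : R[i]) : complex.Im (x - y) = complex.Im x - complex.Im y by case: x; case: y.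
have RE (z : R[i]) : `|complex.Re z|%:C <= `|z| := normc_ge_Re z.
have IM (z : R[i]) : `|complex.Im z|%:C <= `|z|.
  by case: z => a b; rewrite normc_def lecR /= -sqrtr_sqr ler_wsqrtr// lerDr sqr_ge0.
have cc (p : R[i] -> R) : (forall x y, p (x - y) = p x - p y) ->
    (forall z, `|p z|%:C <= `|z|) -> cvg (p @ F).
  move=> pB pe; apply: R_complete; apply/cauchy_ballP => e e0.
  have e0' : 0 < e%:C by rewrite ltcR.
  have [[A B] /= [FA FB] AB] := Fc _ e0'; exists (p @` A, p @` B) => /=.
    by split; [apply: filterS FA | apply: filterS FB] => z ?; exists z.
  move=> [_ _] /= [[x Ax <-] [y By <-]].
  have := AB (x, y) (conj Ax By); rewrite -!ball_normE /= => H.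
  by rewrite -pB -ltcR; apply: le_lt_trans H.
have /cvg_ex[/= a Fa] := cc _ ReB RE; have /cvg_ex[/= b Fb] := cc _ ImB IM.
apply/cvg_ex; exists (a +i* b); apply/cvgrPdist_lt => -[e e'].
rewrite ltcE/= => /andP[/eqP-> e0].
near=> z.
have -> : a +i* b - z = (a - complex.Re z)%:C + (b - complex.Im z)%:C * 'i.
  by rewrite {1}(complexE z); simpc.
rewrite (le_lt_trans (ler_normD _ _))// normrM.
have -> : `|'i%C| = 1 :> R[i] by rewrite normc_def/= expr0n/= expr1n add0r sqrtr1.
rewrite mulr1 !normc_def /= expr0n /= !addr0 !sqrtr_sqr -rmorphD /= ltcR [ltRHS]splitr ltrD//; near: z.
  by move/cvgrPdist_lt: Fa; apply; rewrite divr_gt0.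
by move/cvgrPdist_lt: Fb; apply; rewrite divr_gt0.
Unshelve. all: by end_near. Qed.

End complex_complete.

(* R[i] as a Hilbert space. An alias is needed because the completeness
   instance of the library on R^o is reserved to R : realType. *)
Definition complex_line (R : realType) : Type := R[i]^o.
HB.instance Definition _ (R : realType) := NormedModule.copy (complex_line R) R[i]^o.
HB.instance Definition _ (R : realType) :=
  Uniform_isComplete.Build (complex_line R) (@complex_complete R).
(* {dot H for conj}: positive definite, linear in the first variable and
   conjugate-linear in the second one. Norms take their values in R[i]. *)
HB.mixin Record isHilbert (R : realType) (H : Type) & NormedModule R[i] H := {
  hdot : {dot H for (@Num.conj R[i])} ;
  hdot_norm : forall u : H, `|u| ^+ 2 = hdot u u
}.
#[short(type="hilbertType")]
HB.structure Definition Hilbert (R : realType) :=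
  {H of CompleteNormedModule R[i] H & isHilbert R H}.

Section dot_norm.
Variables (C : numClosedFieldType) (U : lmodType C) (form : {dot U for (@Num.conj C)}).
Local Notation "''[' u , v ]" := (form u%R v%R) : ring_scope.

Lemma dot_ge0 u : 0 <= '[u, u].
Proof. by have [->|/neq0_dnorm_gt0/ltW//] := eqVneq u 0; rewrite linear0r. Qed.

Lemma dot_conj u v : '[u, v] = ('[v, u])^*.
Proof. by rewrite (hermitian_subproof (s := form)) expr0 mul1r. Qed.

Lemma cauchy_schwarz u v : `|'[u, v]| ^+ 2 <= '[u, u] * '[v, v].
Proof.
have [->|v0] := eqVneq v 0; first by rewrite !linear0r normr0 expr0n mulr0.
have vv := neq0_dnorm_gt0 (s := form) _ v0.
have := dot_ge0 ('[v, v] *: u - '[u, v] *: v).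
rewrite linearBl/= !linearBr/= !linearZl_LR !linearZr_LR/= -[('[v, v])^*]dot_conj.
rewrite -[('[u, v])^*]dot_conj [X in 0 <= X](_ : _ =
  '[v, v] * ('[u, u] * '[v, v] - '[u, v] * '[v, u])); last by ring.
by rewrite pmulr_rge0// subr_ge0 normCK -dot_conj.
Qed.

Definition dot_norm u := sqrtC '[u, u].

Lemma dot_norm_ge0 u : 0 <= dot_norm u.
Proof. by rewrite sqrtC_ge0 dot_ge0. Qed.

Lemma dot_norm_sqr u : dot_norm u ^+ 2 = '[u, u].
Proof. exact: sqrtCK. Qed.

Lemma dot_le u v : `|'[u, v]| <= dot_norm u * dot_norm v.
Proof.
rewrite -(@ler_pXn2r _ 2)// ?nnegrE ?mulr_ge0 ?dot_norm_ge0//.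
by rewrite exprMn !dot_norm_sqr cauchy_schwarz.
Qed.

Lemma dot_normD u v : dot_norm (u + v) <= dot_norm u + dot_norm v.
Proof.
rewrite -(@ler_pXn2r _ 2)// ?nnegrE ?addr_ge0 ?dot_norm_ge0//.
rewrite dot_norm_sqr linearDl/= !linearDr/= sqrrD !dot_norm_sqr.
rewrite addrA lerD2r -addrA lerD2l.
have ruv : '[u, v] + '[v, u] \is Num.real.
  by rewrite CrealE rmorphD/= -!dot_conj addrC.
rewrite (le_trans (real_ler_norm ruv))// (le_trans (ler_normD _ _))//.
by rewrite mulr2n lerD// ?dot_le// mulrC dot_le.
Qed.

Lemma dot_normZ a u : dot_norm (a *: u) = `|a| * dot_norm u.
Proof.
apply/eqP; rewrite -(@eqrXn2 _ 2)// ?mulr_ge0 ?dot_norm_ge0//.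
by rewrite exprMn !dot_norm_sqr linearZl_LR linearZr_LR/= mulrA normCK.
Qed.

Lemma dot_norm_eq0 u : dot_norm u = 0 -> u = 0.
Proof.
move=> /eqP; rewrite sqrtC_eq0; apply: contraTeq => /neq0_dnorm_gt0 u0.
by rewrite gt_eqF// u0.
Qed.

End dot_norm.

Section usum.
Context (R : realType) (I : choiceType) (V : normedModType R[i]).
Implicit Types (F : I -> V) (A B : {fset I}).

Definition fset_filter : set_system {fset I} :=
  filter_from setT (fun A => [set B | (A `<=` B)%fset]).

Global Instance fset_filter_proper : ProperFilter fset_filter.
Proof.
apply: filter_from_proper; last by move=> A _; exists A => /=.
apply: filter_from_filter; first by exists fset0.
move=> A B _ _; exists (A `|` B)%fset => // D /=.
by rewrite fsubUset => /andP[].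
Qed.

(* Unordered sums: limits of the net of finite partial sums. *)
Definition psum F A : V := \sum_(i <- A) F i.

Definition usum F : V := lim (psum F @ fset_filter).

Definition has_usum F (s : V) := psum F @ fset_filter --> s.

Definition abs_summable F :=
  exists M : R[i], forall A, \sum_(i <- A) `|F i| <= M.

Lemma fset_filter_ge A : \forall B \near fset_filter, (A `<=` B)%fset.
Proof. by exists A. Qed.

Lemma usumP F : cvg (psum F @ fset_filter) -> has_usum F (usum F).
Proof. by []. Qed.

Lemma has_usumE F s : has_usum F s -> usum F = s.
Proof. by move=> h; apply: cvg_lim h. Qed.

End usum.

Section usum_complete.
Context (R : realType) (I : choiceType).

Lemma psum_sub (V : zmodType) (f : I -> V) (A B : {fset I}) : (A `<=` B)%fset ->
  \sum_(i <- B) f i = \sum_(i <- A) f i + \sum_(i <- (B `\` A)%fset) f i.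
Proof.
move=> AB; rewrite (big_fsetID _ (fun i => i \in A))/=; congr (_ + _).
  apply: eq_fbigl => i; rewrite !inE; case iA : (i \in A); rewrite ?andbF// andbT.
  by rewrite (fsubsetP AB).
by apply: eq_fbigl => i; rewrite !inE andbC.
Qed.

Lemma psum_le (C : numDomainType) (f : I -> C) (A B : {fset I}) :
  (forall i, 0 <= f i) -> (A `<=` B)%fset ->
  \sum_(i <- A) f i <= \sum_(i <- B) f i.
Proof. by move=> f0 AB; rewrite (psum_sub _ AB) lerDl sumr_ge0. Qed.

Lemma bounded_tail (f : I -> R[i]) (M : R[i]) :
  (forall i, 0 <= f i) -> (forall A : {fset I}, \sum_(i <- A) f i <= M) ->
  forall e, 0 < e -> exists A : {fset I}, forall B : {fset I},
    [disjoint A & B]%fset -> \sum_(i <- B) f i < e.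
Proof.
move=> f0 fM [e e'].
rewrite ltcE/= => /andP[/eqP-> e0].
have sR (A : {fset I}) : \sum_(i <- A) f i = ((complex.Re (\sum_(i <- A) f i))%:C)%C.
  by rewrite RRe_real// ger0_real// sumr_ge0.
pose S := [set complex.Re (\sum_(i <- A) f i) | A in [set: {fset I}]].
have hS : has_sup S.
  split; first by exists (complex.Re (\sum_(i <- fset0) f i)), fset0.
  exists (complex.Re M) => _ [A _ <-].
  by have := fM A; rewrite lecE => /andP[].
have [_ [A _ <-] HA] := sup_adherent e0 hS.
exists A => B AB.
have AUB : (A `<=` A `|` B)%fset by exact: fsubsetUl.
have : complex.Re (\sum_(i <- (A `|` B)%fset) f i) <= sup S.
  by apply: ub_le_sup; [case: hS | exists (A `|` B)%fset].
rewrite (psum_sub _ AUB) (_ : ((A `|` B) `\` A)%fset = B); last first.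
  apply/fsetP => i; rewrite !inE; case iA : (i \in A) => //=.
  by apply/esym/negbTE/(fdisjointP AB).
rewrite sR (sR B) -rmorphD/= => H; rewrite ltcR.
by rewrite -(ltrD2l (complex.Re (\sum_(i <- A) f i))); apply: le_lt_trans H _; rewrite -ltrBlDr.
Qed.

Lemma abs_summable_cvg (V : completeNormedModType R[i]) (F : I -> V) :
  abs_summable F -> cvg (psum F @ @fset_filter I).
Proof.
move=> [M FM]; apply: cauchy_cvg; apply/cauchy_ballP => e e0.
have e2 : 0 < e / 2 by rewrite divr_gt0.
have [A HA] := bounded_tail (fun i => normr_ge0 (F i)) FM e2.
pose N := psum F @` [set B | (A `<=` B)%fset].
exists (N, N) => /=.
  by split; exists A => // B AB; exists B.
move=> [_ _] /= [[B AB <-] [D AD <-]].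
rewrite -ball_normE/= /psum (psum_sub _ AB) (psum_sub _ AD).
rewrite opprD addrACA subrr add0r (le_lt_trans (ler_normB _ _))// [ltRHS]splitr.
by rewrite ltrD// (le_lt_trans (ler_norm_sum _ _ _))// HA//;
  apply/fdisjointP => i iA; rewrite !inE iA.
Qed.

End usum_complete.

Section cvg_complex.
Context (R : realType) (T : Type) (F : set_system T) {FF : ProperFilter F}.
Local Notation C := R[i].
Implicit Types (f : T -> complex_line R) (a : complex_line R).

Lemma cvg_conj f a : f @ F --> a -> (fun t => (f t : C)^* : complex_line R) @ F --> ((a : C)^* : complex_line R).
Proof.
move=> /cvgrPdist_lt fa; apply/cvgrPdist_lt => e e0.
near=> t; rewrite -rmorphB norm_conjC; near: t; exact: fa.
Unshelve. all: by end_near. Qed.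

Lemma approx_ge0 (a : C) :
  (forall e, 0 < e -> exists2 z, 0 <= z & `|a - z| < e) -> 0 <= a.
Proof.
move=> h; suff : `|a - `|a| | <= 0 by rewrite normr_le0 subr_eq0 => /eqP ->.
have [//|] := real_leP (normr_real _) (real0 C); rewrite -/(_ < _) => n0.
have [|z z0 az] := h (`|a - `|a| | / 2); first by rewrite divr_gt0.
suff : `|a - `|a| | < `|a - `|a| | by rewrite ltxx.
rewrite [ltRHS]splitr.
rewrite (le_lt_trans (ler_distD z _ _))// ltr_leD//.
rewrite -{1}(ger0_norm z0) (le_trans (ler_dist_dist _ _))// distrC ltW//.
Qed.

Lemma cvg_ge f a (c : C) : f @ F --> a -> (\forall t \near F, c <= (f t : C)) -> c <= (a : C).
Proof.
move=> /cvgrPdist_lt fa fc; rewrite -subr_ge0; apply: approx_ge0 => e e0.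
near F => t; exists ((f t : C) - c); first by rewrite subr_ge0; near: t.
have -> : (a : C) - c - ((f t : C) - c) = (a : C) - (f t : C) by rewrite opprB addrA subrK.
by near: t; exact: fa.
Unshelve. all: by end_near. Qed.

Lemma cvg_le f a (c : C) : f @ F --> a -> (\forall t \near F, (f t : C) <= c) -> (a : C) <= c.
Proof.
move=> /cvgrPdist_lt fa fc; rewrite -subr_ge0; apply: approx_ge0 => e e0.
near F => t; exists (c - (f t : C)); first by rewrite subr_ge0; near: t.
have -> : c - (a : C) - (c - (f t : C)) = - ((a : C) - (f t : C)).
  by rewrite !opprB addrC addrA subrK.
by rewrite normrN; near: t; exact: fa.
Unshelve. all: by end_near. Qed.

End cvg_complex.

(* ell2 I H is the Hilbert space of square-summable families (f i : H), that
   is H (x) l_2(I); l_2(I) itself is ell2 I (complex_line R). *)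
Section ell2.
Context (R : realType) (I : choiceType) (H : hilbertType R).
Local Notation C := R[i].
Implicit Types (f g : I -> H) (A B : {fset I}).

Definition square_summable f :=
  exists M : C, forall A, \sum_(i <- A) `|f i| ^+ 2 <= M.

Definition ell2_pred : {pred I -> H} := [pred f | `[< square_summable f >]].

Lemma ell2_submod : submod_closed ell2_pred.
Proof.
split.
  apply/asboolP; exists 0 => A; rewrite big1// => i _.
  by rewrite normr0 expr0n.
move=> a f g /asboolP[M fM] /asboolP[N gN]; apply/asboolP.
exists ((`|a| ^+ 2 * M + N) *+ 2) => A.
apply: (@le_trans _ _ (\sum_(i <- A) (`|a| ^+ 2 * `|f i| ^+ 2 + `|g i| ^+ 2) *+ 2)).
  apply: ler_sum => i _.
  apply: (@le_trans _ _ ((`|a| * `|f i| + `|g i|) ^+ 2)).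
    rewrite ler_pXn2r ?nnegrE ?addr_ge0 ?mulr_ge0//.
    by rewrite (le_trans (ler_normD _ _))// normrZ.
  rewrite -exprMn -subr_ge0 (_ : _ - _ = (`|a| * `|f i| - `|g i|) ^+ 2); last by ring.
  by rewrite real_exprn_even_ge0// realB// ger0_real// ?mulr_ge0//.
rewrite sumrMnl ler_wMn2r// big_split/= -mulr_sumr lerD//.
  by rewrite ler_wpM2l// exprn_ge0.
exact: gN.
Qed.

HB.instance Definition _ :=
  GRing.isSubmodClosed.Build C (I -> H) ell2_pred ell2_submod.

Record ell2 : Type := Ell2 {
  ell2_fun :> I -> H ;
  ell2_funP : ell2_fun \in ell2_pred }.

HB.instance Definition _ := [isSub for ell2_fun].
HB.instance Definition _ := [Choice of ell2 by <:].
HB.instance Definition _ := [SubChoice_isSubLmodule of ell2 by <:].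

Implicit Types (x y : ell2).

Lemma ell2P x y : (forall i, x i = y i) -> x = y.
Proof. by move=> xy; apply: val_inj; apply: funext. Qed.

Lemma ell2_bound x : square_summable x.
Proof. by apply/asboolP/(ell2_funP x). Qed.

Lemma ell2D x y i : (x + y) i = x i + y i.
Proof. by []. Qed.

Lemma ell2B x y i : (x - y) i = x i - y i.
Proof. by []. Qed.

Lemma ell2Z (a : C) x i : (a *: x) i = a *: x i.
Proof. by []. Qed.

Definition ell2_dot x y : C := usum (fun i => hdot (x i) (y i) : complex_line R).

Lemma hdot_le (u v : H) : `|hdot u v| <= `|u| * `|v|.
Proof.
rewrite (le_trans (dot_le hdot u v))// /dot_norm -!hdot_norm.
by rewrite !sqrCK.
Qed.

Lemma ell2_dot_cvg x y :
  has_usum (fun i => hdot (x i) (y i) : complex_line R) (ell2_dot x y).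
Proof.
apply: usumP; apply: abs_summable_cvg.
have [M xM] := ell2_bound x; have [N yN] := ell2_bound y.
exists (M + N) => A.
apply: (@le_trans _ _ (\sum_(i <- A) (`|x i| ^+ 2 + `|y i| ^+ 2))); last first.
  by rewrite big_split/= lerD.
apply: ler_sum => i _; apply: le_trans (hdot_le _ _) _.
rewrite -subr_ge0; set a := `|x i|; set b := `|y i|.
rewrite (_ : _ - _ = (a - b) ^+ 2 + a * b); last by ring.
apply: addr_ge0; last exact: mulr_ge0 (normr_ge0 _) (normr_ge0 _).
by rewrite real_exprn_even_ge0// realB// normr_real.
Qed.

Lemma ell2_bilinear : bilinear_for
  (GRing.Scale.Law.clone _ _ *%R _)
  (GRing.Scale.Law.clone _ _ ((@Num.conj C) \; *%R) _) ell2_dot.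
Proof.
split=> [y a x x'|x a y y'] /=; apply: (@has_usumE _ _ (complex_line R)).
  rewrite /has_usum (_ : psum _ = (fun A => a *: psum (fun i => hdot (x i) (y i) : complex_line R) A
     + psum (fun i => hdot (x' i) (y i) : complex_line R) A)).
    by apply: cvgD; [apply: cvgZr; exact: ell2_dot_cvg|exact: ell2_dot_cvg].
  apply: funext => A; rewrite /psum scaler_sumr -big_split; apply: eq_bigr => i _.
  by rewrite linearPl.
rewrite /has_usum (_ : psum _ = (fun A => a^* *: psum (fun i => hdot (x i) (y i) : complex_line R) A
     + psum (fun i => hdot (x i) (y' i) : complex_line R) A)).
  by apply: cvgD; [apply: cvgZr; exact: ell2_dot_cvg|exact: ell2_dot_cvg].
apply: funext => A; rewrite /psum scaler_sumr -big_split; apply: eq_bigr => i _.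
by rewrite linearPr.
Qed.

Lemma ell2_hermitian x y : ell2_dot x y = (-1) ^+ false * (ell2_dot y x)^*.
Proof.
rewrite expr0 mul1r; apply: (@has_usumE _ _ (complex_line R)); rewrite /has_usum.
rewrite (_ : psum _ = (fun A => (psum (fun i => hdot (y i) (x i) : complex_line R) A)^*)).
  apply: (@cvg_conj _ _ _ _ (psum (fun i => hdot (y i) (x i) : complex_line R))).
  exact: ell2_dot_cvg.
apply: funext => A; rewrite /psum rmorph_sum; apply: eq_bigr => i _.
exact: dot_conj.
Qed.

Lemma psum_dot x A :
  psum (fun i => hdot (x i) (x i) : complex_line R) A = \sum_(i <- A) `|x i| ^+ 2.
Proof. by apply: eq_bigr => i _; rewrite hdot_norm. Qed.

Lemma ell2_dot_ge0 x : 0 <= ell2_dot x x.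
Proof.
apply: (cvg_ge (@ell2_dot_cvg x x)); near=> A.
by rewrite psum_dot sumr_ge0// => i _; rewrite exprn_ge0.
Unshelve. all: by end_near. Qed.

Lemma psum_le_dot x A : \sum_(i <- A) `|x i| ^+ 2 <= ell2_dot x x.
Proof.
apply: (cvg_ge (@ell2_dot_cvg x x)); near=> B; rewrite psum_dot.
apply: psum_le; first by move=> i; rewrite exprn_ge0.
by near: B; exact: fset_filter_ge.
Unshelve. all: by end_near. Qed.

Lemma ell2_dot_le x (M : C) :
  (forall A, \sum_(i <- A) `|x i| ^+ 2 <= M) -> ell2_dot x x <= M.
Proof.
move=> xM; apply: (cvg_le (@ell2_dot_cvg x x)); near=> B.
by rewrite psum_dot.
Unshelve. all: by end_near. Qed.

Lemma ell2_dot_gt0 x : x != 0 -> 0 < ell2_dot x x.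
Proof.
move=> x0; rewrite lt_def ell2_dot_ge0 andbT; apply: contraNneq x0 => x0.
apply/eqP/ell2P => i; have := psum_le_dot x [fset i]%fset.
rewrite big_seq_fset1 x0 => xi.
have : `|x i| ^+ 2 == 0 by rewrite eq_le xi exprn_ge0.
by rewrite expf_eq0/= normr_eq0 => /eqP.
Qed.

HB.instance Definition _ := bilinear_isBilinear.Build C ell2 ell2 C
  (GRing.Scale.Law.clone _ _ *%R _)
  (GRing.Scale.Law.clone _ _ ((@Num.conj C) \; *%R) _) ell2_dot ell2_bilinear.
HB.instance Definition _ := isHermitianSesquilinear.Build C ell2 false
  (@Num.conj C) ell2_dot ell2_hermitian.
HB.instance Definition _ := isDotProduct.Build C ell2 ell2_dot ell2_dot_gt0.

Let form : {dot ell2 for (@Num.conj C)} := ell2_dot.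

HB.instance Definition _ := Lmodule_isNormed.Build C ell2
  (@dot_normD _ _ form) (@dot_normZ _ _ form) (@dot_norm_eq0 _ _ form).

Lemma ell2_normE x : `|x| ^+ 2 = ell2_dot x x.
Proof. exact: (@dot_norm_sqr _ _ form). Qed.

Lemma ell2_psum_le x A : \sum_(i <- A) `|x i| ^+ 2 <= `|x| ^+ 2.
Proof. by rewrite ell2_normE psum_le_dot. Qed.

Lemma ell2_norm_le x (M : C) : 0 <= M ->
  (forall A, \sum_(i <- A) `|x i| ^+ 2 <= M ^+ 2) -> `|x| <= M.
Proof.
move=> M0 xM; rewrite -(@ler_pXn2r _ 2)// ?nnegrE//.
by rewrite ell2_normE ell2_dot_le.
Qed.

Lemma ell2_coord_le x i : `|x i| <= `|x|.
Proof.
rewrite -(@ler_pXn2r _ 2)// ?nnegrE//.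
by have := ell2_psum_le x [fset i]%fset; rewrite big_seq_fset1.
Qed.

Lemma cvg_sum_sqr (F : set_system ell2) (x l : I -> H) A : Filter F ->
  (forall i, (fun y : ell2 => y i) @ F --> l i) ->
  (fun y : ell2 => \sum_(i <- A) `|x i - y i| ^+ 2 : complex_line R) @ F -->
  (\sum_(i <- A) `|x i - l i| ^+ 2 : complex_line R).
Proof.
move=> FF lP; elim: (enum_fset A) => [|i s IH].
  rewrite big_nil (_ : (fun _ => _) = fun=> 0); first exact: cvg_cst.
  by apply: funext => y; rewrite big_nil.
have c : (fun y : ell2 => `|x i - y i| : R[i]^o) @ F --> (`|x i - l i| : R[i]^o).
  by apply: cvg_norm; apply: cvgB; [exact: cvg_cst|exact: lP].
have c2 := cvgD (cvgZ c c) IH.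
rewrite big_cons expr2.
have -> : (fun y : ell2 => \sum_(j <- i :: s) `|x j - y j| ^+ 2 : complex_line R) =
  (fun y : ell2 => `|x i - y i| * `|x i - y i| + \sum_(j <- s) `|x j - y j| ^+ 2).
  by apply: funext => y; rewrite big_cons expr2.
exact: c2.
Qed.

Lemma ell2_complete (F : set_system ell2) : ProperFilter F -> cauchy F -> cvg F.
Proof.
move=> FF /cauchy_ballP Fc.
have ci i : cvg ((fun x => x i) @ F).
  apply: cauchy_cvg; apply/cauchy_ballP => e e0.
  have [[A B] /= [FA FB] AB] := Fc _ e0.
  exists ((fun x => x i) @` A, (fun x => x i) @` B) => /=.
    by split; [apply: filterS FA | apply: filterS FB] => z ?; exists z.
  move=> [_ _] /= [[x Ax <-] [y By <-]].
  have := AB (x, y) (conj Ax By); rewrite -!ball_normE /=.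
  by apply: le_lt_trans; rewrite -ell2B ell2_coord_le.
pose l i : H := lim ((fun x => x i) @ F).
have lP i : (fun x => x i) @ F --> l i by exact: ci.
have key (e : C) : 0 < e -> \forall x \near F, forall A, \sum_(i <- A) `|(x : ell2) i - l i| ^+ 2 <= e ^+ 2.
  move=> e0; have [[A B] /= [FA FB] AB] := Fc _ e0.
  near=> x => D.
  have Ax : A x by near: x.
  have xy (y : ell2) : B y -> \sum_(i <- D) `|x i - y i| ^+ 2 <= e ^+ 2.
    move=> By; have := AB (x, y) (conj Ax By); rewrite -ball_normE /= => xye.
    apply: le_trans (ell2_psum_le (x - y) D) _.
    by rewrite ler_pXn2r ?nnegrE// ltW.
  have c : (fun y : ell2 => \sum_(i <- D) `|x i - y i| ^+ 2 : complex_line R) @ F -->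
      (\sum_(i <- D) `|x i - l i| ^+ 2 : complex_line R).
    exact: cvg_sum_sqr.
  by apply: (cvg_le c); near=> y; apply: xy; near: y.
have [x0 Hx0] := filter_ex (key 1 ltr01).
have lell : l \in ell2_pred.
  rewrite (_ : l = ell2_fun x0 - (ell2_fun x0 - l)); last by rewrite opprB addrC subrK.
  apply: rpredB; first exact: ell2_funP.
  by apply/asboolP; exists (1 ^+ 2) => A; exact: Hx0.
apply/cvg_ex; exists (Ell2 lell); apply/cvgrPdist_lt => e e0.
have e2 : 0 < e / 2 by rewrite divr_gt0.
near=> x; rewrite distrC (@le_lt_trans _ _ (e / 2))//; last first.
  by rewrite ltr_pdivrMr// ltr_pMr// ltr1n.
apply: ell2_norm_le; first exact: ltW.
by near: x; exact: (key _ e2).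
Unshelve. all: by end_near. Qed.

HB.instance Definition _ := Uniform_isComplete.Build ell2 ell2_complete.
HB.instance Definition _ := isHilbert.Build R ell2 ell2_normE.

End ell2.

(* bop H is B(H): a unital algebra (x * y is composition, 1 the identity),
   normed by the operator norm. *)
Section bop.
Context (R : realType) (H : hilbertType R).
Local Notation C := R[i].

Definition bounded_linear (T : H -> H) :=
  linear T /\ exists M : C, forall u, `|T u| <= M * `|u|.

Definition bop_pred : {pred H -> H} := [pred T | `[< bounded_linear T >]].

Lemma bop_submod : submod_closed bop_pred.
Proof.
split.
  apply/asboolP; split; first by move=> a u v; rewrite scaler0 addr0.
  by exists 0 => u; rewrite normr0 mul0r.
move=> a S T /asboolP[Sl [M SM]] /asboolP[Tl [N TN]]; apply/asboolP; split.
  move=> b u v; rewrite !addrfctE !scalrfctE Sl Tl !scalerDr !scalerA mulrC.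
  by rewrite addrACA.
exists (`|a| * M + N) => u; rewrite addrfctE scalrfctE.
by rewrite (le_trans (ler_normD _ _))// mulrDl lerD// normrZ -mulrA ler_wpM2l.
Qed.

HB.instance Definition _ :=
  GRing.isSubmodClosed.Build C (H -> H) bop_pred bop_submod.

Record bop : Type := Bop {
  bop_fun :> H -> H ;
  bop_funP : bop_fun \in bop_pred }.

HB.instance Definition _ := [isSub for bop_fun].
HB.instance Definition _ := [Choice of bop by <:].
HB.instance Definition _ := [SubChoice_isSubLmodule of bop by <:].

Implicit Types (S T U : bop).

Lemma bopP S T : (forall u, S u = T u) -> S = T.
Proof. by move=> ST; apply: val_inj; apply: funext. Qed.

Lemma bopL T : linear T.
Proof. by have /asboolP[] := bop_funP T. Qed.

Lemma bopB T : exists M : C, forall u, `|T u| <= M * `|u|.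
Proof. by have /asboolP[] := bop_funP T. Qed.

HB.instance Definition _ T := GRing.isLinear.Build C H H *:%R T (bopL T).

Lemma bop1_subproof : idfun \in bop_pred.
Proof.
apply/asboolP; split => // ; exists 1 => u; by rewrite mul1r.
Qed.

Lemma bopM_subproof S T : S \o T \in bop_pred.
Proof.
apply/asboolP; split; first by move=> a u v; rewrite /= !linearP.
have [M SM] := bopB S; have [N TN] := bopB T.
exists (`|M| * N) => u /=; apply: (@le_trans _ _ (`|M| * `|T u|)).
  have := normr_ge0 (S (T u)); have := SM (T u).
  case: (eqVneq (T u) 0) => [->|Tu0]; first by rewrite linear0 !normr0 !mulr0.
  move=> /[swap] S0 SM'; apply: le_trans (SM') _.
  have M0 : 0 <= M by rewrite -(@pmulr_lge0 _ `|T u|) ?normr_gt0// (le_trans S0).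
  by rewrite (ger0_norm M0).
by rewrite -mulrA ler_wpM2l.
Qed.

Definition bop1 : bop := Bop bop1_subproof.
Definition bopM S T : bop := Bop (bopM_subproof S T).

Fact bopMA : associative bopM. Proof. by move=> S T U; apply: bopP. Qed.
Fact bop1M : left_id bop1 bopM. Proof. by move=> T; apply: bopP. Qed.
Fact bopM1 : right_id bop1 bopM. Proof. by move=> T; apply: bopP. Qed.
Fact bopMDl : left_distributive bopM +%R. Proof. by move=> S T U; apply: bopP. Qed.
Fact bopMDr : right_distributive bopM +%R.
Proof. by move=> S T U; apply: bopP => u; exact: linearD. Qed.

HB.instance Definition _ :=
  GRing.Zmodule_isPzRing.Build bop bopMA bop1M bopM1 bopMDl bopMDr.

Definition opnorm T : C :=
  ((sup [set complex.Re `|T u| | u in [set u : H | `|u| <= 1]])%:C)%C.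

Let nRe (u : H) : ((complex.Re `|u|)%:C)%C = `|u|.
Proof. by rewrite RRe_real// normr_real. Qed.

Let has_sup_op T : has_sup [set complex.Re `|T u| | u in [set u : H | `|u| <= 1]].
Proof.
split; first by exists (complex.Re `|T 0|), 0 => //=; rewrite normr0.
have [M TM] := bopB T; exists (complex.Re `|M|) => _ [u u1 <-].
rewrite -lecR nRe RRe_real ?normr_real//; move: u1 => /= u1.
case: (eqVneq u 0) => [->|u0]; first by rewrite linear0 normr0.
have M0 : 0 <= M.
  by rewrite -(@pmulr_lge0 _ `|u|) ?normr_gt0// (le_trans (normr_ge0 (T u))).
rewrite ger0_norm//; apply: le_trans (TM u) _.
by rewrite -[leRHS]mulr1 ler_wpM2l.
Qed.

Lemma opnorm_ge0 T : 0 <= opnorm T.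
Proof.
rewrite ler0c (@le_trans _ _ (complex.Re `|T 0|))//.
  by rewrite linear0 normr0.
by apply: ub_le_sup; [case: (has_sup_op T)|exists 0 => //=; rewrite normr0].
Qed.

Lemma opnormP T u : `|T u| <= opnorm T * `|u|.
Proof.
case: (eqVneq u 0) => [->|u0]; first by rewrite linear0 !normr0 mulr0.
have u1 : 0 < `|u| by rewrite normr_gt0.
rewrite -ler_pdivrMr// mulrC -[X in X * _]ger0_norm ?invr_ge0// -normrZ -linearZ/=.
rewrite -[X in X <= _]nRe /opnorm lecR; apply: ub_le_sup; first by case: (has_sup_op T).
exists (`|u|^-1 *: u) => //=; by rewrite normfZV.
Qed.

Lemma opnorm_le T (M : C) : 0 <= M -> (forall u, `|T u| <= M * `|u|) -> opnorm T <= M.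
Proof.
move=> M0 TM; rewrite -(RRe_real (ger0_real M0)) /opnorm lecR.
apply: ge_sup; first by case: (has_sup_op T).
move=> _ [u /= u1 <-]; rewrite -lecR nRe RRe_real ?ger0_real//.
by apply: le_trans (TM u) _; rewrite -[leRHS]mulr1 ler_wpM2l.
Qed.

Lemma opnormD S T : opnorm (S + T) <= opnorm S + opnorm T.
Proof.
apply: opnorm_le => [|u]; first by rewrite addr_ge0 ?opnorm_ge0.
by rewrite (le_trans (ler_normD _ _))// mulrDl lerD ?opnormP.
Qed.

Lemma opnormZ a T : opnorm (a *: T) = `|a| * opnorm T.
Proof.
have le1 b S : opnorm (b *: S) <= `|b| * opnorm S.
  apply: opnorm_le => [|u]; first by rewrite mulr_ge0 ?opnorm_ge0.
  by rewrite normrZ -mulrA ler_wpM2l// opnormP.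
have [->|a0] := eqVneq a 0.
  apply/eqP; rewrite eq_le le1/= normr0 mul0r opnorm_ge0//.
apply/eqP; rewrite eq_le le1/=.
rewrite -ler_pdivlMl ?normr_gt0//.
by rewrite -normfV -{1}(scalerK a0 T) le1.
Qed.

Lemma opnorm0_eq0 T : opnorm T = 0 -> T = 0.
Proof.
move=> T0; apply: bopP => u; apply/eqP; rewrite -normr_eq0 eq_le normr_ge0 andbT.
by have := opnormP T u; rewrite T0 mul0r.
Qed.

HB.instance Definition _ :=
  Lmodule_isNormed.Build C bop opnormD opnormZ opnorm0_eq0.

End bop.

Section complex_line_hilbert.
Context (R : realType).
Local Notation C := R[i].

Definition complex_line_dot (z w : complex_line R) : C := (z : C) * (w : C)^*.

Fact complex_line_dot_bilinear : bilinear_for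
  (GRing.Scale.Law.clone _ _ *%R _)
  (GRing.Scale.Law.clone _ _ ((@Num.conj C) \; *%R) _) complex_line_dot.
Proof.
split=> [w a z z'|z a w w']; rewrite /complex_line_dot /=.
  by rewrite mulrDl -mulrA.
by rewrite rmorphD rmorphM mulrDr mulrCA.
Qed.

Fact complex_line_dot_hermitian (z w : complex_line R) :
  complex_line_dot z w = (-1) ^+ false * (complex_line_dot w z)^*.
Proof. by rewrite expr0 mul1r /complex_line_dot rmorphM/= conjCK mulrC. Qed.

Fact complex_line_dot_gt0 (z : complex_line R) : z != 0 -> 0 < complex_line_dot z z.
Proof. by move=> z0; rewrite /complex_line_dot -normCK exprn_gt0// normr_gt0. Qed.

HB.instance Definition _ := bilinear_isBilinear.Build C (complex_line R) (complex_line R) C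
  (GRing.Scale.Law.clone _ _ *%R _)
  (GRing.Scale.Law.clone _ _ ((@Num.conj C) \; *%R) _) complex_line_dot complex_line_dot_bilinear.
HB.instance Definition _ := isHermitianSesquilinear.Build C (complex_line R) false
  (@Num.conj C) complex_line_dot complex_line_dot_hermitian.
HB.instance Definition _ := isDotProduct.Build C (complex_line R) complex_line_dot complex_line_dot_gt0.

Fact complex_line_dot_norm (z : complex_line R) : `|z| ^+ 2 = complex_line_dot z z.
Proof. exact: normCK. Qed.

HB.instance Definition _ := isHilbert.Build R (complex_line R) complex_line_dot_norm.

End complex_line_hilbert.

Section basis.
Context (R : realType) (I : choiceType).
Local Notation C := R[i].

Fact delta_subproof (j : I) : (fun i => (i == j)%:R) \in @ell2_pred R I (complex_line R).
Proof.
apply/asboolP; exists 1 => A.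
have -> : \sum_(i <- A) `|(i == j)%:R : complex_line R| ^+ 2 =
    \sum_(i <- A | i == j) (1 : C).
  rewrite [RHS]big_mkcond; apply: eq_bigr => i _.
  by case: (i == j); rewrite ?normr0 ?expr0n// [X in X ^+ 2]normr1 expr1n.
rewrite -big_filter big_const_seq/= count_predT -/(_ *+ _).
rewrite iter_addr addr0 -[X in _ <= X]mulr1n ler_pMn2l ?ltr01//.
rewrite size_filter (@count_uniq_mem _ (enum_fset A) j) ?fset_uniq//.
exact: leq_b1.
Qed.

Definition delta j : ell2 I (complex_line R) := Ell2 (delta_subproof j).

End basis.
Arguments delta {R I} j.

Section tensor.
Context (R : realType) (I : choiceType) (H : hilbertType R).
Local Notation C := R[i].

Fact tensor_subproof (u : H) (xi : ell2 I (complex_line R)) :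
  (fun i => (xi i : C) *: u) \in @ell2_pred R I H.
Proof.
apply/asboolP; have [M xM] := ell2_bound xi; exists (M * `|u| ^+ 2) => A.
under eq_bigr do rewrite normrZ exprMn.
by rewrite -mulr_suml ler_wpM2r// exprn_ge0.
Qed.

Definition tensor u xi : ell2 I H := Ell2 (tensor_subproof u xi).

Lemma tensor_dot u v xi eta :
  hdot (tensor u xi) (tensor v eta) = hdot u v * hdot xi eta.
Proof.
apply: (@has_usumE _ _ (complex_line R)).
rewrite /has_usum.
have -> : psum (fun i => hdot (tensor u xi i) (tensor v eta i) : complex_line R) =
  (fun A => hdot u v *: psum (fun i => hdot (xi i) (eta i) : complex_line R) A).
  apply: funext => A; rewrite /psum scaler_sumr; apply: eq_bigr => i _ /=.
  rewrite linearZl_LR linearZr_LR/= mulrA mulrC; congr (_ * _).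
by apply: cvgZr; exact: (@ell2_dot_cvg R I (complex_line R) xi eta).
Qed.

Lemma tensor_norm u xi : `|tensor u xi| = `|u| * `|xi|.
Proof.
apply/eqP; rewrite -(@eqrXn2 _ 2)// ?mulr_ge0//.
by rewrite exprMn !hdot_norm tensor_dot.
Qed.

Lemma tensorP (xi : ell2 I (complex_line R)) : linear (fun u : H => tensor u xi).
Proof.
by move=> a u v; apply: ell2P => i; rewrite ell2D ell2Z /= scalerDr !scalerA [a * _]mulrC.
Qed.

Fact block_subproof (x : bop (ell2 I H)) (i j : I) :
  (fun u => x (tensor u (delta j)) i) \in @bop_pred R H.
Proof.
apply/asboolP; split; first by move=> a u v; rewrite tensorP linearP ell2D ell2Z.
exists (opnorm x * `|delta j : ell2 I (complex_line R)|) => u.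
rewrite (le_trans (ell2_coord_le _ _))// (le_trans (opnormP _ _))//.
by rewrite tensor_norm -mulrA (mulrC `|u|).
Qed.

(* x = sum_(i, j) block x i j (x) e_(i, j) *)
Definition block x i j : bop H := Bop (block_subproof x i j).

Lemma ell2_approx (f : ell2 I H) (e : C) : 0 < e ->
  exists A : {fset I}, `|f - \sum_(j <- A) tensor (f j) (delta j)| <= e.
Proof.
move=> e0; have [M fM] := ell2_bound f.
have [|A HA] := bounded_tail (fun i => exprn_ge0 2 (normr_ge0 (f i))) fM (_ : 0 < e ^+ 2).
  by rewrite exprn_gt0.
exists A; apply: ell2_norm_le; first exact: ltW.
have fA i : (f - \sum_(j <- A) tensor (f j) (delta j)) i =
    if i \in A then 0 else f i.
  have sumE (s : seq I) : (\sum_(j <- s) tensor (f j) (delta j)) i =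
      \sum_(j <- s) tensor (f j) (delta j) i.
    by elim: s => [|j s IH]; rewrite ?big_nil// !big_cons ell2D IH.
  rewrite ell2B sumE; case: ifPn => iA.
    rewrite (big_fsetD1 i iA)/= eqxx scale1r big_seq big1 ?addr0 ?subrr// => j.
    by rewrite !inE eq_sym => /andP[/negbTE -> _]; rewrite scale0r.
  rewrite big_seq big1 ?subr0// => j jA /=.
  by rewrite (_ : i == j = false) ?scale0r//; apply: contraNF iA => /eqP ->.
move=> B; under eq_bigr do rewrite fA.
rewrite (big_fsetID _ (fun i => i \in A))/= big_seq big1 ?add0r; last first.
  by move=> i; rewrite !inE => /andP[_ ->]; rewrite normr0 expr0n.
apply: (@le_trans _ _ (\sum_(i <- [fset x in B | x \notin A]%fset) `|f i| ^+ 2)).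
  apply: ler_sum => i _; case: ifP => //.
  by rewrite normr0 expr0n exprn_ge0.
apply/ltW/HA/fdisjointP => i iA; by rewrite !inE iA andbF.
Qed.

Lemma block_inj x y : (forall i j, block x i j = block y i j) -> x = y.
Proof.
move=> xy; apply: bopP => f.
have xyt u j : x (tensor u (delta j)) = y (tensor u (delta j)).
  apply: ell2P => i; exact: (congr1 (fun T : bop H => T u) (xy i j)).
apply/eqP; rewrite -subr_eq0 -normr_le0.
have M0 : 0 <= opnorm (x - y) := opnorm_ge0 (x - y).
suff h (e : C) : 0 < e -> `|x f - y f| <= (opnorm (x - y)) * e.
  have [//|n0] := real_leP (normr_real (x f - y f)) (real0 C).
  have [M00|M1] := eqVneq (opnorm (x - y)) 0.
    have := h 1 ltr01; rewrite M00 mul0r => /le_lt_trans /(_ n0).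
    by rewrite ltxx.
  have Mgt : 0 < opnorm (x - y) by rewrite lt_def M1.
  have /h : 0 < `|x f - y f| / 2 / opnorm (x - y) by rewrite !divr_gt0.
  rewrite mulrC divfK// => le2.
  suff : `|x f - y f| < `|x f - y f| by rewrite ltxx.
  by apply: le_lt_trans le2 _; rewrite ltr_pdivrMr// ltr_pMr// ltr1n.
move=> e0; have [A fA] := ell2_approx f e0.
have -> : x f - y f = (x - y) (f - \sum_(j <- A) tensor (f j) (delta j)).
  rewrite [RHS]linearB linear_sum [X in _ = _ - X]big1 ?subr0// => j _.
  by apply/eqP; rewrite subr_eq0; apply/eqP; exact: xyt.
by rewrite (le_trans (opnormP _ _))// ler_wpM2l.
Qed.

(* The operator with block matrix M, unique by block_inj (0 if M is not the
   matrix of a bounded operator). *)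
Definition block_operator (M : I -> I -> bop H) : bop (ell2 I H) :=
  xget 0 [set x | forall i j, block x i j = M i j].

End tensor.

Section translation.
Context (R : realType) (G : groupType) (H : hilbertType R).
Local Notation C := R[i].

Lemma translate_sum (g : G) (f : ell2 G H) (A : {fset G}) :
  \sum_(h <- A) `|f (g^-1 * h)%g| ^+ 2 <= `|f| ^+ 2.
Proof.
rewrite (_ : \sum_(h <- A) _ = \sum_(h <- [fset (g^-1 * h)%g | h in A]%fset) `|f h| ^+ 2).
  exact: ell2_psum_le.
by rewrite big_imfset//= => h h' _ _; exact: mulgI.
Qed.

Fact translate_ell2_subproof (g : G) (f : ell2 G H) :
  (fun h => f (g^-1 * h)%g) \in @ell2_pred R G H.
Proof. by apply/asboolP; exists (`|f| ^+ 2) => A; exact: translate_sum. Qed.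

Definition translate_ell2 g f : ell2 G H := Ell2 (translate_ell2_subproof g f).

Fact translate_subproof (g : G) : translate_ell2 g \in @bop_pred R (ell2 G H).
Proof.
apply/asboolP; split; first by move=> a f f'; apply: ell2P.
exists 1 => f; rewrite mul1r; apply: ell2_norm_le => // A.
exact: translate_sum.
Qed.

(* I_H (x) lambda_g, see translate_tensor below. *)
Definition translate g : bop (ell2 G H) := Bop (translate_subproof g).

End translation.

Section lambda.
Context (R : realType) (G : groupType).

Definition lambda (g : G) : bop (ell2 G (complex_line R)) := translate _ g.

Lemma lambda_delta g h : lambda g (delta h) = delta (g * h)%g.
Proof.
apply: ell2P => i /=; congr ((_ : bool)%:R).
by rewrite -(inj_eq (mulgI g)) mulVKg.
Qed.

Lemma translate_tensor (H : hilbertType R) g (u : H) (xi : ell2 G (complex_line R)) :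
  translate H g (tensor u xi) = tensor u (lambda g xi).
Proof. exact: ell2P. Qed.

End lambda.
Arguments lambda {R G} g.

Section von_neumann.
Context (R : realType).
Local Notation C := R[i].

(* Closure of S in the coarsest topology making all the w j continuous. *)
Definition initial_closure (X : choiceType) (J : Type) (w : J -> X -> C)
    (S : set X) : set X :=
  @closure (initial_topology
    (fun x : X => (fun j => w j x) : {ptws J -> complex_line R})) S.

Context (H : hilbertType R).
Implicit Types (A S : set (bop H)) (x y : bop H).

Definition wot_closure : set (bop H) -> set (bop H) :=
  initial_closure (fun (uv : H * H) x => hdot (x uv.1) uv.2).

(* The ultra-weakly continuous functionals are x |-> sum_n <x u_n, v_n> with
   (u_n) and (v_n) square-summable. *)
Definition ultraweak_closure : set (bop H) -> set (bop H) :=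
  initial_closure (fun (uv : ell2 nat H * ell2 nat H) x =>
    usum (fun n => hdot (x (uv.1 n)) (uv.2 n) : complex_line R)).

(* y is the adjoint of x *)
Definition is_adjoint x y := forall u v, hdot (x u) v = hdot u (y v).

Definition von_neumann_algebra A :=
  [/\ A 1,
      forall (a : C) x y, A x -> A y -> A (a *: x + y),
      forall x y, A x -> A y -> A (x * y),
      forall x y, is_adjoint x y -> A x -> A y &
      wot_closure A `<=` A].

Definition norm_one_projection A (E : bop H -> bop H) :=
  [/\ linear E, forall x, A (E x), forall x, A x -> E x = x &
      forall x, `|E x| <= `|x|].

(* Injectivity in the sense of Tomiyama and Connes. *)
Definition injective_algebra A := exists E, norm_one_projection A E.

Definition conditional_expectation A (E : bop H -> bop H) :=
  norm_one_projection A E /\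
  forall a b x, A a -> A b -> E (a * x * b) = a * E x * b.

(* Maps on A are represented by functions on B(H) whose values outside A are
   irrelevant. *)
Definition star_automorphism A (phi : bop H -> bop H) :=
  [/\ set_bij A A phi,
      forall (a : C) x y, A x -> A y -> phi (a *: x + y) = a *: phi x + phi y,
      forall x y, A x -> A y -> phi (x * y) = phi x * phi y &
      forall x y, A x -> is_adjoint x y -> is_adjoint (phi x) (phi y)].

Definition is_action (G : groupType) A (alpha : G -> bop H -> bop H) :=
  [/\ forall g, star_automorphism A (alpha g),
      forall x, A x -> alpha 1%g x = x &
      forall g h x, A x -> alpha (g * h)%g x = alpha g (alpha h x)].

(* Positivity in M_n(B(H)) = B(H^n). *)
Definition positive_mx n (x : 'M[bop H]_n) :=
  forall v : 'I_n -> H, 0 <= \sum_i \sum_j hdot (x i j (v j)) (v i).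

End von_neumann.

Definition completely_positive (R : realType) (H K : hilbertType R)
    (phi : bop H -> bop K) :=
  linear phi /\
  forall n (x : 'M[bop H]_n), positive_mx x -> positive_mx (map_mx phi x).

Section crossed_product.
Context (R : realType) (H : hilbertType R) (G : groupType).
Local Notation C := R[i].
Variables (A : set (bop H)) (alpha : G -> bop H -> bop H).

(* sum_g alpha_(g^-1)(r) (x) e_(g, g) *)
Definition Psi (r : bop H) : bop (ell2 G H) :=
  block_operator (fun g h => if g == h then alpha g^-1%g r else 0).

Definition crossed_generators : set (bop (ell2 G H)) :=
  [set translate H g * Psi r | g in setT & r in A].

Definition crossed_span : set (bop (ell2 G H)) :=
  [set x | exists n (c : 'I_n -> C) (y : 'I_n -> bop (ell2 G H)),
    (forall i, crossed_generators (y i)) /\ x = \sum_i c i *: y i].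

Definition crossed_product : set (bop (ell2 G H)) :=
  ultraweak_closure crossed_span.

Variables (pi : bop H -> bop H) (k : ell2 G (complex_line R)).

(* The (i, j) entry of sum_(g, h) L_(g h^-1) Psi (alpha_h (pi x_(g, h))) conj(k_g) k_h
   only involves the pairs (g, h) with g h^-1 = i j^-1; sigma_term is the
   contribution of h to it. *)
Definition sigma_term (x : bop (ell2 G H)) (i j h : G) : bop H :=
  let g := (i * j^-1 * h)%g in
  ((k g : C)^* * k h) *: alpha (j^-1 * h)%g (pi (block x g h)).

Definition sigma (x : bop (ell2 G H)) : bop (ell2 G H) :=
  block_operator (fun i j => usum (sigma_term x i j)).

End crossed_product.

(* Main.v *)
Require Import Defs.
From HB Require Import structures.
From mathcomp Require Import all_boot all_order all_algebra finmap.
From mathcomp Require Import boolp classical_sets functions reals topology normedtype.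
From mathcomp Require Import sequences sesquilinear complex ring.
Set Implicit Arguments.
Unset Strict Implicit.
Unset Printing Implicit Defensive.

Import Order.TTheory GRing.Theory Num.Theory.
Import numFieldNormedType.Exports.
Local Open Scope classical_set_scope.
Local Open Scope ring_scope.

(** Put [Theta_t := alpha_t o pi]. Substituting [h = j t] in the [(i, j)] entry
    of [sigma x] turns it into

      [sum_t conj(k_(i t)) k_(j t) Theta_t (x_(i t, j t))],

    so that [sigma] is a sum over [t] of very simple maps: move the blocks of
    [x] by the right translation by [t], apply [Theta_t] to every block, and
    multiply on both sides by a diagonal matrix with entries [k_(j t)]. Since
    each [Theta_t] is unital and completely positive and the weights satisfy
    [sum_t |k_(j t)|^2 = 1], everything but the algebraic identities follows
    by adding up estimates for a fixed [t] on finitely supported vectors.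

    For [pi] complete positivity is a hypothesis; for [alpha_t] it has to be
    proved, from the algebraic properties alone. A positive matrix over the
    von Neumann algebra, increased by a small multiple of the identity, is a
    square of a self-adjoint matrix over the same algebra, because the square
    root is a norm limit of polynomials ([positive_sqrt]); an automorphism maps
    such a square to a positive matrix ([star_positive_kernel]).

    For the boundedness of [sigma x], adjoints exist by Riesz representation,
    and the matrix with diagonal blocks [c >= |x|] and off-diagonal blocks [x]
    and its adjoint is positive. Applying [Theta_t] to its entries bounds
    [- 2 Re (Theta_t(x) v, w)] by [c (|v|^2 + |w|^2)]
    ([unital_positive_bound]). Unlike a bound on the norm, this inequality is
    additive in the weights, hence survives the summation over [t]
    ([twisted_quad_bounded]), and a block matrix which satisfies it defines a
    bounded operator ([quad_bounded_operator]).

    The same estimate holds when the two occurrences of [xi] are independent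
    vectors, and it is sesquilinear in them. Hence [sigma x] depends norm
    continuously on [xi]. When [xi] is replaced by a finitely supported vector,
    [sigma x] is a finite combination of the operators [L_g Psi(r)]; so
    [sigma x] is a norm limit of such combinations, and a fortiori it belongs
    to their ultraweak closure ([sigma_crossed]).

    Bimodularity and the eigenvalue equation are identities between the terms
    of the series of each entry; unitality is the eigenvalue equation at
    [L_1 Psi(1)]. *)

(** * Continuity of bounded maps *)

Section continuity.
Context (R : realType).
Local Notation C := R[i].

Lemma lipschitz_cvg (V W : normedModType C) (f : V -> W) (M : C)
    (T : Type) (F : set_system T) {FF : Filter F} (u : T -> V) (l : V) :
  (forall x y, `|f x - f y| <= M * `|x - y|) ->
  u @ F --> l -> (fun t => f (u t)) @ F --> f l.
Proof.
move=> fM /cvgrPdist_lt ul; apply/cvgrPdist_lt => e e0.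
have N0 : 0 < `|M| + 1 by rewrite ltr_wpDl.
have eN : 0 < e / (`|M| + 1) by rewrite divr_gt0.
near=> t; rewrite (le_lt_trans (fM _ _))//.
have ut : `|l - u t| < e / (`|M| + 1) by near: t; exact: ul.
rewrite ltr_pdivlMr// in ut; apply: le_lt_trans ut; rewrite mulrDr mulr1 mulrC.
have r : `|l - u t| * M <= `|l - u t| * `|M|.
  have [->|n0] := eqVneq `|l - u t| 0; first by rewrite !mul0r.
  have n0' : 0 < `|l - u t| by rewrite lt_def n0 normr_ge0.
  have M0 : 0 <= M by rewrite -(pmulr_lge0 _ n0') (le_trans (normr_ge0 _) (fM _ _)).
  by rewrite (ger0_norm M0).
by rewrite (le_trans r)// lerDl.
Unshelve. all: by end_near. Qed.

(** An initial topology given by norm continuous functionals is coarser than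
    the norm topology. This covers at once the two closures at stake, in the
    weak operator and in the ultraweak topology. *)
Lemma norm_limit_initial_closure (V : normedModType C) (J : Type)
    (w : J -> V -> C) (S : set V) (x : V) :
  (forall j, continuous (w j : V -> complex_line R)) ->
  (forall e : C, 0 < e -> exists2 y, S y & `|x - y| <= e) ->
  initial_closure w S x.
Proof.
move=> wc Sx; rewrite /initial_closure.
set W := fun y : V => _.
have Wc : continuous (W : V -> {ptws J -> complex_line R}).
  move=> y; apply/cvg_sup => j U.
  case=> _ [[B oB <-] By] BU.
  have := wc j y; rewrite /continuous_at => /(_ B).
  move=> /(_ (open_nbhs_nbhs (conj oB By))) wB.
  apply: (@filterS V (nbhs y) _ ((w j : V -> complex_line R) @^-1` B)) => // z Bz.
  exact: BU.
rewrite closureEnbhs => A B AS.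
case=> _ [[P oP <-] /= Px] PB.
have {PB} Bx : nbhs x B.
  have := Wc x P (open_nbhs_nbhs (conj oP Px)).
  by apply: (@filterS V (nbhs x)) => a; exact: PB.
move/nbhs_ballP: Bx => [e /= e0 eB].
have [y Sy xy] := Sx (e / 2) ltac:(by rewrite divr_gt0).
exists y; split; first exact: AS.
apply: eB; rewrite -ball_normE /=.
by rewrite (le_lt_trans xy)// ltr_pdivrMr// ltr_pMr// ltr1n.
Qed.

Lemma additive_bounded_cvg (V W : normedModType C) (f : {additive V -> W}) (M : C)
    (T : Type) (F : set_system T) {FF : Filter F} (u : T -> V) (l : V) :
  (forall x, `|f x| <= M * `|x|) ->
  u @ F --> l -> (fun t => f (u t)) @ F --> f l.
Proof.
by move=> fM; apply: (@lipschitz_cvg _ _ _ M) => x y; rewrite -raddfB; exact: fM.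
Qed.

Lemma bop_norm_le (H : hilbertType R) (T : bop H) u : `|T u| <= `|T| * `|u|.
Proof. exact: opnormP. Qed.

Lemma bop_cvg (H : hilbertType R) (T : bop H) (X : Type) (F : set_system X)
    {FF : Filter F} (u : X -> H) (l : H) :
  u @ F --> l -> (fun t => T (u t)) @ F --> T l.
Proof. exact: (additive_bounded_cvg (opnormP T)). Qed.

(** Common source of the joint continuity of the inner product, of the
    evaluation of operators and of their composition. *)
Lemma bilinear_bounded_cvg (U V W : normedModType C) (b : U -> V -> W)
    (X : Type) (F : set_system X) {FF : Filter F}
    (u : X -> U) (l : U) (v : X -> V) (m : V) :
  (forall x x' y, b (x - x') y = b x y - b x' y) ->
  (forall x y y', b x (y - y') = b x y - b x y') ->
  (forall x y, `|b x y| <= `|x| * `|y|) ->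
  u @ F --> l -> v @ F --> m -> (fun t => b (u t) (v t)) @ F --> b l m.
Proof.
move=> bl br bM ul vm.
have b0 (w : X -> U) (z : X -> V) : w @ F --> (0 : U) -> z @ F --> (0 : V) ->
    (fun t => b (w t) (z t)) @ F --> (0 : W).
  move=> /cvgrPdist_lt w0 /cvgrPdist_lt z0; apply/cvgrPdist_lt => e e0.
  near=> t; rewrite sub0r normrN (le_lt_trans (bM _ _))//.
  have wt : `|w t| < 1 by rewrite -[w t]opprK normrN -sub0r; near: t; exact: w0.
  have zt : `|z t| < e by rewrite -[z t]opprK normrN -sub0r; near: t; exact: z0.
  by rewrite (le_lt_trans _ zt)// ler_piMl// ltW.
have ul0 : (fun t => u t - l) @ F --> (0 : U).
  by rewrite -[X in _ --> X](subrr l); apply: cvgB => //; exact: cvg_cst.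
have vm0 : (fun t => v t - m) @ F --> (0 : V).
  by rewrite -[X in _ --> X](subrr m); apply: cvgB => //; exact: cvg_cst.
(* both variables are centred at their limits, where [b0] applies *)
have -> : (fun t => b (u t) (v t)) =
    (fun t => b (u t - l) (v t - m) + (b l (v t) + (b (u t) m - b l m))).
  by apply: funext => t; rewrite br !bl addrACA subrK addNr addr0.
have bv : (fun t => b l (v t)) @ F --> b l m.
  by apply: (@lipschitz_cvg _ _ (b l) `|l|) vm => x y; rewrite -br bM.
have bu : (fun t => b (u t) m) @ F --> b l m.
  by apply: (@lipschitz_cvg _ _ (b^~ m) `|m|) ul => x y; rewrite -bl mulrC bM.
have lim0 : 0 + (b l m + (b l m - b l m)) = b l m by rewrite subrr addr0 add0r.
have := cvgD (b0 _ _ ul0 vm0) (cvgD bv (cvgB bu (cvg_cst (b l m)))).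
by rewrite lim0 => h; exact: h.
Unshelve. all: by end_near. Qed.

Lemma hdot_cvg (H : hilbertType R) (X : Type) (F : set_system X)
    {FF : Filter F} (u v : X -> H) (l m : H) :
  u @ F --> l -> v @ F --> m ->
  (fun t => hdot (u t) (v t) : complex_line R) @ F --> (hdot l m : complex_line R).
Proof.
apply: (@bilinear_bounded_cvg _ _ _ (fun x y => hdot x y : complex_line R)).
- by move=> x x' y; rewrite linearBl.
- by move=> x y y'; rewrite linearBr.
- by move=> x y; exact: hdot_le.
Qed.

Lemma bop_app_cvg (H : hilbertType R) (X : Type) (F : set_system X)
    {FF : Filter F} (T : X -> bop H) (S : bop H) (u : H) :
  T @ F --> S -> (fun t => T t u) @ F --> S u.
Proof.
move=> TS; apply: (@bilinear_bounded_cvg _ _ _ (fun (S : bop H) u => S u)) TS (cvg_cst u).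
- by [].
- by move=> x y y'; rewrite linearB.
- by move=> x y; exact: opnormP.
Qed.

Lemma bop_normM (H : hilbertType R) (S T : bop H) : `|S * T| <= `|S| * `|T|.
Proof.
apply: opnorm_le => [|u]; first by rewrite mulr_ge0.
by rewrite (le_trans (bop_norm_le S (T u)))// -mulrA ler_wpM2l// bop_norm_le.
Qed.

Lemma bop_mul_cvg (H : hilbertType R) (X : Type) (F : set_system X)
    {FF : Filter F} (S T : X -> bop H) (S0 T0 : bop H) :
  S @ F --> S0 -> T @ F --> T0 -> (fun t => S t * T t) @ F --> S0 * T0.
Proof.
apply: (@bilinear_bounded_cvg _ _ _ (fun S T : bop H => S * T)); last exact: bop_normM.
- by move=> x x' y; rewrite mulrBl.
- by move=> x y y'; rewrite mulrBr.
Qed.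

(** A Cauchy filter of operators converges pointwise; the pointwise limit is
    a limit in norm because the Cauchy estimates are uniform in the vector. *)
Lemma bop_complete (H : hilbertType R) (F : set_system (bop H)) :
  ProperFilter F -> cauchy F -> cvg F.
Proof.
move=> FF /cauchy_ballP Fc.
have ci u : cvg ((fun T : bop H => T u) @ F).
  apply: cauchy_cvg; apply/cauchy_ballP => e e0.
  have n0 : 0 < `|u| + 1 by rewrite ltr_wpDl.
  have [|[A B] /= [FA FB] AB] := Fc (e / (`|u| + 1)); first by rewrite divr_gt0.
  exists ((fun T : bop H => T u) @` A, (fun T : bop H => T u) @` B) => /=.
    by split; [apply: filterS FA | apply: filterS FB] => z ?; exists z.
  move=> [_ _] /= [[S AS <-] [T BT <-]].
  have := AB (S, T) (conj AS BT); rewrite -!ball_normE /= => ST.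
  rewrite -[S u - T u]/((S - T) u) (le_lt_trans (bop_norm_le _ _))//.
  rewrite ltr_pdivlMr// mulrDr mulr1 in ST.
  by apply: le_lt_trans ST; rewrite lerDl.
pose l u : H := lim ((fun T : bop H => T u) @ F).
have lP u : (fun T : bop H => T u) @ F --> l u by exact: ci.
have key (e : C) : 0 < e -> \forall T \near F, forall u, `|(T : bop H) u - l u| <= e * `|u|.
  move=> e0; have [[A B] /= [FA FB] AB] := Fc _ e0.
  near=> T => u.
  have AT : A T by near: T.
  have c : (fun S : bop H => `|T u - S u| : complex_line R) @ F -->
      (`|T u - l u| : complex_line R).
    by apply: cvg_norm; apply: cvgB; [exact: cvg_cst|exact: lP].
  apply: (cvg_le c); near=> S.
  have BS : B S by near: S.
  have := AB (T, S) (conj AT BS); rewrite -ball_normE /= => TS.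
  rewrite -[T u - S u]/((T - S) u) (le_trans (bop_norm_le _ _))//.
  by rewrite ler_wpM2r// ltW.
have llin : linear l.
  move=> a u v; apply: (@cvg_unique _ (@norm_hausdorff _ H) _ _ _ _ (lP _)).
  rewrite (_ : (fun T : bop H => T (a *: u + v)) = (fun T : bop H => a *: T u + T v)).
    by apply: cvgD; [apply: cvgZl_tmp; exact: lP|exact: lP].
  by apply: funext => T; rewrite linearP.
have [T0 HT0] := filter_ex (key 1 ltr01).
have lbop : l \in @bop_pred R H.
  apply/asboolP; split => //; exists (`|T0| + 1) => u.
  have -> : l u = T0 u - (T0 u - l u) by rewrite opprB addrC subrK.
  rewrite (le_trans (ler_normB _ _))// mulrDl lerD ?bop_norm_le//.
apply/cvg_ex; exists (Bop lbop); apply/cvgrPdist_le => e e0.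
near=> T; rewrite distrC; apply: opnorm_le => [|u]; first exact: ltW.
by move: u; near: T; exact: key.
Unshelve. all: by end_near. Qed.

End continuity.

HB.instance Definition _ (R : realType) (H : hilbertType R) :=
  Uniform_isComplete.Build (bop H) (@bop_complete R H).

(** * Unordered sums *)

Section usum_theory.
Context (R : realType) (I : choiceType).
Local Notation C := R[i].
Implicit Types (V W : normedModType C) (A B D : {fset I}).

Lemma has_usum_ext V (F G : I -> V) s : F =1 G -> has_usum F s -> has_usum G s.
Proof. by move=> /funext ->. Qed.

Lemma has_usum_unique V (F : I -> V) s t : has_usum F s -> has_usum F t -> s = t.
Proof. exact: (@cvg_unique _ (@norm_hausdorff _ V)). Qed.

Lemma has_usum_map V W (f : {additive V -> W}) (M : C) (F : I -> V) s :
  (forall x, `|f x| <= M * `|x|) -> has_usum F s -> has_usum (f \o F) (f s).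
Proof.
move=> fM /(additive_bounded_cvg fM); rewrite /has_usum.
have -> : psum (f \o F) = (fun A => f (psum F A)) by apply: funext => A; rewrite raddf_sum.
exact.
Qed.

Lemma has_usum0 V : has_usum (fun _ : I => 0 : V) 0.
Proof.
rewrite /has_usum (_ : psum _ = fun=> 0); first exact: cvg_cst.
by apply: funext => A; rewrite /psum big1.
Qed.

Lemma has_usumD V (F G : I -> V) s t :
  has_usum F s -> has_usum G t -> has_usum (fun i => F i + G i) (s + t).
Proof.
move=> Fs Gt; rewrite /has_usum.
have -> : psum (fun i => F i + G i) = (fun A => psum F A + psum G A).
  by apply: funext => A; rewrite /psum big_split.
exact: cvgD.
Qed.

Lemma has_usumZ V (F : I -> V) (a : C) s :
  has_usum F s -> has_usum (fun i => a *: F i) (a *: s).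
Proof.
move=> Fs; rewrite /has_usum.
have -> : psum (fun i => a *: F i) = (fun A => a *: psum F A).
  by apply: funext => A; rewrite /psum -scaler_sumr.
exact: cvgZl_tmp.
Qed.

Lemma has_usum_sum V (J : Type) (r : seq J) (P : pred J) (F : J -> I -> V) (s : J -> V) :
  (forall j, P j -> has_usum (F j) (s j)) ->
  has_usum (fun i => \sum_(j <- r | P j) F j i) (\sum_(j <- r | P j) s j).
Proof.
move=> Fs; elim: r => [|j r IH].
  by rewrite big_nil; apply: (has_usum_ext _ (@has_usum0 V)) => i; rewrite big_nil.
rewrite big_cons; case: ifPn => Pj.
  by apply: (has_usum_ext _ (has_usumD (Fs j Pj) IH)) => i; rewrite big_cons Pj.
by apply: (has_usum_ext _ IH) => i; rewrite big_cons (negbTE Pj).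
Qed.

Lemma has_usum_finite V (F : I -> V) A :
  (forall i, i \notin A -> F i = 0) -> has_usum F (\sum_(i <- A) F i).
Proof.
move=> F0; rewrite /has_usum; apply: cvg_near_cst; near=> B.
have AB : (A `<=` B)%fset by near: B; exact: fset_filter_ge.
rewrite /psum (psum_sub _ AB) [X in _ + X]big_seq [X in _ + X]big1 ?addr0// => i.
by rewrite !inE => /andP[/F0].
Unshelve. all: by end_near. Qed.

Lemma has_usum_conj (F : I -> complex_line R) (s : complex_line R) :
  has_usum F s ->
  has_usum (fun i => (F i : C)^* : complex_line R) ((s : C)^* : complex_line R).
Proof.
move=> Fs; rewrite /has_usum.
have -> : psum (fun i => (F i : C)^* : complex_line R) =
    (fun A => (psum F A : C)^* : complex_line R).
  by apply: funext => A; rewrite /psum rmorph_sum.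
exact: cvg_conj.
Qed.

Lemma has_usum_ge (F : I -> complex_line R) (s : complex_line R) (c : C) :
  has_usum F s -> (forall A, c <= \sum_(i <- A) (F i : C)) -> c <= (s : C).
Proof. by move=> Fs Fc; apply: (cvg_ge Fs); apply: nearW. Qed.

Lemma has_usum_le (F : I -> complex_line R) (s : complex_line R) (c : C) :
  has_usum F s -> (forall A, \sum_(i <- A) (F i : C) <= c) -> (s : C) <= c.
Proof. by move=> Fs Fc; apply: (cvg_le Fs); apply: nearW. Qed.

Lemma has_usum_norm_le V (F : I -> V) (s : V) (c : C) :
  has_usum F s -> (forall A, `|\sum_(i <- A) F i| <= c) -> `|s| <= c.
Proof.
move=> Fs Fc; have n : (fun A => `|psum F A| : complex_line R) @ fset_filter (I:=I) --> (`|s| : complex_line R).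
  exact: cvg_norm.
by apply: (cvg_le n); apply: nearW => A; exact: Fc.
Qed.

(** The criterion for families such as orthogonal ones, which are summable
    without being absolutely summable. *)
Lemma square_dominated_cvg (V : completeNormedModType C) (F : I -> V) (f : I -> C) (c M : C) :
  0 <= c -> (forall i, 0 <= f i) -> (forall A, \sum_(i <- A) f i <= M) ->
  (forall A, `|\sum_(i <- A) F i| ^+ 2 <= c * \sum_(i <- A) f i) ->
  cvg (psum F @ @fset_filter I).
Proof.
move=> c0 f0 fM Ff; apply: cauchy_cvg; apply/cauchy_ballP => e e0.
have e2 : 0 < e / 2 by rewrite divr_gt0.
have c1 : 0 < c + 1 by rewrite ltr_wpDl.
have [|A HA] := bounded_tail f0 fM (_ : 0 < (e / 2) ^+ 2 / (c + 1)).
  by rewrite divr_gt0// exprn_gt0.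
have tail B : [disjoint A & B]%fset -> `|\sum_(i <- B) F i| < e / 2.
  move=> /HA; rewrite ltr_pdivlMr// => AB.
  rewrite -(@ltr_pXn2r _ 2)// ?nnegrE ?(ltW e2)//.
  rewrite (le_lt_trans (Ff B))// (le_lt_trans _ AB)// mulrC ler_wpM2l ?sumr_ge0//.
  by rewrite lerDl.
pose N := psum F @` [set B | (A `<=` B)%fset].
exists (N, N) => /=.
  by split; exists A => // B AB; exists B.
move=> [_ _] /= [[B AB <-] [D AD <-]].
rewrite -ball_normE/= /psum (psum_sub _ AB) (psum_sub _ AD).
rewrite opprD addrACA subrr add0r (le_lt_trans (ler_normB _ _))// [ltRHS]splitr.
by rewrite ltrD// tail//; apply/fdisjointP => i iA; rewrite !inE iA.
Qed.

End usum_theory.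

Lemma has_usum_reindex (R : realType) (I J : choiceType) (V : normedModType R[i])
    (b : J -> I) (b' : I -> J) (F : I -> V) s :
  cancel b b' -> cancel b' b -> has_usum F s -> has_usum (F \o b) s.
Proof.
move=> bK b'K Fs.
have bE (A : {fset J}) : psum (F \o b) A = psum F [fset b j | j in A]%fset.
  by rewrite /psum big_imfset//= => x y _ _ /(can_inj bK).
rewrite /has_usum (funext bE); apply: cvg_comp Fs.
move=> U [A _ AU]; exists [fset b' i | i in A]%fset => // B /= AB.
apply: AU => /=; apply/fsubsetP => i iA.
rewrite -(b'K i) in_imfset//=; apply: (fsubsetP AB).
by rewrite in_imfset.
Qed.

(** * Riesz representation and adjoints *)

Section riesz.
Context (R : realType) (H : hilbertType R).
Local Notation C := R[i].

Lemma hdot_conj (u v : H) : hdot u v = (hdot v u)^*.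
Proof. exact: dot_conj. Qed.

Lemma add_conj_le (z : C) : z + z^* <= `|z| *+ 2.
Proof.
have r : z + z^* \is Num.real by rewrite CrealE rmorphD/= conjCK addrC.
by rewrite (le_trans (real_ler_norm r))// (le_trans (ler_normD _ _))// norm_conjC mulr2n.
Qed.

Lemma mulr_le_sqrD (a b : C) : 0 <= a -> 0 <= b -> a * b *+ 2 <= a ^+ 2 + b ^+ 2.
Proof.
move=> a0 b0; rewrite -subr_ge0 [X in 0 <= X](_ : _ = (a - b) ^+ 2); last by ring.
by rewrite real_exprn_even_ge0// realB// ger0_real.
Qed.

Lemma hdot_quad_le (T : bop H) (c : C) (v w : H) : `|T| <= c ->
  - (hdot (T v) w + (hdot (T v) w)^*) <= c * (`|v| ^+ 2 + `|w| ^+ 2).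
Proof.
move=> Tc; set t := hdot _ _; have c0 : 0 <= c by rewrite (le_trans _ Tc).
have -> : - (t + t^*) = (- t) + (- t)^* by rewrite rmorphN opprD.
rewrite (le_trans (add_conj_le _))// normrN.
apply: (@le_trans _ _ ((c * (`|v| * `|w|)) *+ 2)); last first.
  by rewrite -mulrnAr ler_wpM2l// mulr_le_sqrD.
rewrite ler_wMn2r// (le_trans (hdot_le _ _))// mulrA ler_wpM2r//.
by rewrite (le_trans (bop_norm_le _ _))// ler_wpM2r.
Qed.

(** Compare an almost minimiser [u] of [J u = |u|^2 - 2 Re (phi u)] with
    [u + a z]. With [d = (z, u) - phi z], the best choice of [a] decreases [J]
    by [|d|^2 / |z|^2], which is therefore at most the defect of minimality. *)
Lemma approx_riesz (phi : H -> C) (M : C) : 0 <= M ->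
  (forall a u v, phi (a *: u + v) = a * phi u + phi v) ->
  (forall u, `|phi u| <= M * `|u|) ->
  forall e, 0 < e -> exists u, forall z, `|hdot z u - phi z| <= e * `|z|.
Proof.
move=> M0 phiP phiM e e0.
pose J u := hdot u u - (phi u + (phi u)^*).
have Jreal u : J u \is Num.real.
  by rewrite CrealE rmorphB rmorphD/= conjCK -hdot_conj [_^* + _]addrC.
have JE u : ((complex.Re (J u))%:C)%C = J u by rewrite RRe_real.
have Jlow u : - M ^+ 2 <= J u.
  rewrite /J -hdot_norm lerBrDr addrC -lerBrDr opprK.
  rewrite (le_trans (add_conj_le _))//.
  apply: (@le_trans _ _ ((M * `|u|) *+ 2)); first by rewrite ler_wMn2r.
  rewrite -subr_ge0 [X in 0 <= X](_ : _ = (M - `|u|) ^+ 2); last by ring.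
  by rewrite real_exprn_even_ge0// realB// ger0_real.
pose S := [set complex.Re (J u) | u in [set: H]].
have hS : has_inf S.
  split; first by exists (complex.Re (J 0)), 0.
  exists (complex.Re (- M ^+ 2)) => _ [u _ <-].
  by have := Jlow u; rewrite lecE => /andP[].
have e20 : 0 < e ^+ 2 by rewrite exprn_gt0.
have e2E : ((complex.Re (e ^+ 2))%:C)%C = e ^+ 2 by rewrite RRe_real// gtr0_real.
have [|_ [u _ <-] Hu] := @inf_adherent _ S (complex.Re (e ^+ 2)) _ hS.
  by rewrite -ltcR e2E.
have Jmin w : J u <= J w + e ^+ 2.
  rewrite -JE -[J w]JE -e2E -rmorphD lecR (le_trans (ltW Hu))// lerD2r.
  by apply: ge_inf; [case: hS|exists w].
exists u => z; set d := hdot z u - phi z.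
have [z0|z0] := eqVneq z 0.
  rewrite /d z0 linear0l normr0 mulr0; have := phiM 0.
  by rewrite normr0 mulr0 sub0r normrN.
have n0 : 0 < `|z| by rewrite normr_gt0.
have zz : hdot z z = `|z| ^+ 2 by rewrite hdot_norm.
(* the minimiser of [a |-> J (a z + u)] *)
pose a := - (d^* / `|z| ^+ 2).
have ac : a^* = - (d / `|z| ^+ 2).
  by rewrite /a rmorphN/= rmorphM/= conjCK fmorphV/= rmorphXn/= (geC0_conj (normr_ge0 _)).
have := Jmin (a *: z + u).
have -> : J (a *: z + u) = J u - `|d| ^+ 2 / `|z| ^+ 2.
  rewrite /J phiP rmorphD rmorphM /= linearDl/= !linearDr/= !linearZl_LR !linearZr_LR/=.
  rewrite [hdot u z]hdot_conj zz ac.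
  have -> : phi z = hdot z u - d by rewrite /d opprB addrC subrK.
  rewrite rmorphB/= normCK /a; field.
  by rewrite gt_eqF.
rewrite -addrA -{1}[J u]addr0 lerD2l addrC subr_ge0 ler_pdivrMr ?exprn_gt0//.
by rewrite -exprMn ler_pXn2r ?nnegrE// mulr_ge0// ltW.
Qed.

(** Two vectors [u] and [v] that represent [phi] up to [e] satisfy
    [|(z, u - v)| <= 2 e |z|] for all [z], in particular for [z = u - v]. So the
    almost representing vectors form a Cauchy filter; its limit represents
    [phi]. *)
Lemma riesz (phi : H -> C) (M : C) : 0 <= M ->
  (forall a u v, phi (a *: u + v) = a * phi u + phi v) ->
  (forall u, `|phi u| <= M * `|u|) ->
  exists u, forall z, phi z = hdot z u.
Proof.
move=> M0 phiP phiM.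
pose B e := [set u : H | forall z, `|hdot z u - phi z| <= e * `|z|].
pose F : set_system H := filter_from [set e : C | 0 < e] B.
have FF : ProperFilter F.
  apply: filter_from_proper; last exact: approx_riesz phiP phiM.
  apply: filter_from_filter; first by exists 1 => /=.
  move=> e e' /= e0 e'0.
  have cmp : e >=< e' by rewrite real_comparable// gtr0_real.
  exists (Num.min e e') => /=; first by rewrite comparable_lt_min ?e0 ?e'0// ?real_comparable.
  by move=> u uB; split=> z; rewrite (le_trans (uB z))// ler_wpM2r//
    comparable_ge_min// lexx ?orbT.
have Fc : cauchy F.
  apply/cauchy_ballP => e e0; have e3 : 0 < e / 3%:R by rewrite divr_gt0.
  exists (B (e / 3%:R), B (e / 3%:R)) => /=; first by split; exists (e / 3%:R).
  move=> [u v] /= [uB vB]; rewrite -ball_normE /=.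
  set z := u - v; have [->|z0] := eqVneq z 0; first by rewrite normr0.
  have n0 : 0 < `|z| by rewrite normr_gt0.
  have : `|z| ^+ 2 <= (e / 3%:R) * `|z| + (e / 3%:R) * `|z|.
    have -> : `|z| ^+ 2 = `|hdot z u - hdot z v|.
      by rewrite -linearBr/= -/z -hdot_norm ger0_norm// exprn_ge0.
    have -> : hdot z u - hdot z v = (hdot z u - phi z) - (hdot z v - phi z).
      by rewrite opprB addrA subrK.
    by rewrite (le_trans (ler_normB _ _))// lerD.
  rewrite -mulrDl expr2 ler_pM2r// => zl; rewrite (le_lt_trans zl)//.
  rewrite -[ltRHS]mulr1 -mulrDr ltr_pM2l// -[X in X + X]mul1r -mulrDl.
  by rewrite ltr_pdivrMr// mul1r -[1 + 1]/(2%:R) ltr_nat.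
have /cvg_ex[/= u Fu] : cvg F by exact: cauchy_cvg.
exists u => z; apply/eqP; rewrite eq_sym -subr_eq0 -normr_le0.
have c : (fun v => `|hdot z v - phi z| : complex_line R) @ F -->
    (`|hdot z u - phi z| : complex_line R).
  have FF' : Filter F by exact: @filter_filter _ _ FF.
  have cz : (fun=> z) @ F --> z by exact: cvg_cst.
  have zu := @hdot_cvg R H _ F FF' (fun=> z) id z u cz Fu.
  have cp : (fun=> (phi z : complex_line R)) @ F --> (phi z : complex_line R) by exact: cvg_cst.
  exact: cvg_norm (cvgB zu cp).
have small e : 0 < e -> `|hdot z u - phi z| <= e * `|z|.
  by move=> e0; apply: (cvg_le c); exists e.
have [->|z0] := eqVneq z 0.
  rewrite linear0l sub0r normrN; have := phiM 0.
  by rewrite normr0 mulr0.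
have n0 : 0 < `|z| by rewrite normr_gt0.
set d := `|_|; have [//|d0] := real_leP (normr_real (hdot z u - phi z)) (real0 C).
have := small (d / 2%:R / `|z|) ltac:(by rewrite !divr_gt0).
rewrite divfK ?gt_eqF// -/d ler_pdivlMr// -{2}[d]mulr1 ler_pM2l//.
by rewrite -[X in _ <= X]mulr1n ler_nat.
Qed.

Lemma adjoint_exists (T : bop H) : exists S, is_adjoint T S.
Proof.
have ex v : exists w, forall u, hdot (T u) v = hdot u w.
  apply: (@riesz (fun u => hdot (T u) v) (`|T| * `|v|)).
  - by rewrite mulr_ge0.
  - by move=> a u w; rewrite linearP linearPl.
  - move=> u; rewrite (le_trans (hdot_le _ _))// mulrAC ler_wpM2r//.
    exact: bop_norm_le.
have [S SP] := choice ex.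
have SB v : `|S v| <= `|T| * `|v|.
  have [->|n0] := eqVneq (S v) 0; first by rewrite normr0 mulr_ge0.
  have n0' : 0 < `|S v| by rewrite normr_gt0.
  rewrite -(ler_pM2r n0') -expr2 hdot_norm -SP.
  rewrite -[hdot _ _]ger0_norm ?SP -?hdot_norm ?exprn_ge0// hdot_norm -SP.
  rewrite (le_trans (hdot_le _ _))// mulrAC ler_wpM2r//; exact: bop_norm_le.
have SL : linear S.
  move=> a v w; apply/eqP; rewrite -subr_eq0 -normr_eq0; set x := S _ - _.
  have : `|x| ^+ 2 = 0.
    rewrite hdot_norm {2}/x linearBr/= linearDr/= linearZr_LR/= -!SP.
    by rewrite linearDr/= linearZr_LR/= subrr.
  by move=> /eqP; rewrite expf_eq0.
have Sp : S \in @bop_pred R H by apply/asboolP; split => //; exists `|T|.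
by exists (Bop Sp) => u v /=; exact: SP.
Qed.

End riesz.

(** * Operators given by a block matrix *)

Section block_criterion.
Context (R : realType) (I : choiceType) (H : hilbertType R).
Local Notation C := R[i].
Implicit Types (A B D E : {fset I}) (f g : ell2 I H).

Definition ell2_coord (i : I) (f : ell2 I H) : H := f i.
Fact ell2_coord_linear i : linear (ell2_coord i). Proof. by []. Qed.
HB.instance Definition _ i :=
  GRing.isLinear.Build C (ell2 I H) H *:%R (ell2_coord i) (ell2_coord_linear i).

Lemma ell2_coord_bound i f : `|ell2_coord i f| <= 1 * `|f|.
Proof. by rewrite mul1r ell2_coord_le. Qed.

Lemma ell2_sumE (J : Type) (r : seq J) (P : pred J) (F : J -> ell2 I H) i :
  (\sum_(j <- r | P j) F j) i = \sum_(j <- r | P j) F j i.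
Proof. exact: (linear_sum (ell2_coord i)). Qed.

Lemma bop_sumE (K : hilbertType R) (J : Type) (r : seq J) (P : pred J)
    (F : J -> bop K) u :
  (\sum_(j <- r | P j) F j) u = \sum_(j <- r | P j) F j u.
Proof. by elim/big_rec2: _ => // j y z _ <-. Qed.

Lemma tensor_delta_in (u : H) (i : I) : tensor u (delta i) i = u.
Proof. by rewrite /= eqxx scale1r. Qed.

Lemma tensor_delta_out (u : H) (i j : I) : j != i -> tensor u (delta i) j = 0.
Proof. by move=> /= /negbTE ->; rewrite scale0r. Qed.

Lemma hdot_tensor_delta f (u : H) (i : I) : hdot f (tensor u (delta i)) = hdot (f i) u.
Proof.
apply: (has_usum_unique (@ell2_dot_cvg R I H f (tensor u (delta i)))).
have := @has_usum_finite R I (complex_line R)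
  (fun j => hdot (f j) (tensor u (delta i) j) : complex_line R) [fset i]%fset.
rewrite big_seq_fset1 tensor_delta_in; apply => j; rewrite !inE => ji.
by rewrite tensor_delta_out// linear0r.
Qed.

Definition fin_supp A (v : I -> H) : ell2 I H := \sum_(j <- A) tensor (v j) (delta j).

Lemma fin_suppE A v i : fin_supp A v i = if i \in A then v i else 0.
Proof.
rewrite ell2_sumE; case: ifPn => iA; last first.
  rewrite big_seq big1// => j jA; rewrite tensor_delta_out//.
  by apply: contraNneq iA => ->.
rewrite (big_fsetD1 i iA)/= -/(tensor _ _ _) eqxx scale1r big_seq big1 ?addr0// => j.
by rewrite !inE eq_sym => /andP[/negbTE -> _]; rewrite scale0r.
Qed.

Lemma hdot_fin_supp f A v : hdot f (fin_supp A v) = \sum_(i <- A) hdot (f i) (v i).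
Proof.
rewrite /fin_supp linear_sumr/=; apply: eq_bigr => i _; exact: hdot_tensor_delta.
Qed.

Lemma sum_fset_if (V : nmodType) A B (F : I -> V) : (A `<=` B)%fset ->
  \sum_(i <- B) (if i \in A then F i else 0) = \sum_(i <- A) F i.
Proof.
move=> AB; rewrite -big_mkcond big_fset_condE/=; apply: eq_fbigl => i.
by rewrite !inE; case: (boolP (i \in A)) => iA; rewrite ?andbF// (fsubsetP AB).
Qed.

Lemma norm_fin_supp A v : `|fin_supp A v| ^+ 2 = \sum_(i <- A) `|v i| ^+ 2.
Proof.
rewrite hdot_norm hdot_fin_supp big_seq [RHS]big_seq; apply: eq_bigr => i iA.
by rewrite fin_suppE iA hdot_norm.
Qed.

Lemma ell2_has_usum f : has_usum (fun j => tensor (f j) (delta j)) f.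
Proof.
have [M fM] := ell2_bound f.
have /cvg_ex[/= g fg] : cvg (psum (fun j => tensor (f j) (delta j)) @ @fset_filter I).
  apply: (@square_dominated_cvg _ _ _ _ (fun i => `|f i| ^+ 2) 1 M) => //.
    by move=> i; rewrite exprn_ge0.
  by move=> A; rewrite mul1r norm_fin_supp.
suff fE : f = g by rewrite [X in has_usum _ X]fE.
apply: ell2P => i.
have gi := has_usum_map (f := ell2_coord i) (ell2_coord_bound i) fg.
apply: has_usum_unique gi; rewrite -{1}(tensor_delta_in (f i) i).
have := @has_usum_finite R I H (fun j => ell2_coord i (tensor (f j) (delta j))) [fset i]%fset.
rewrite big_seq_fset1; apply => j; rewrite !inE => ji.
by rewrite /ell2_coord tensor_delta_out// eq_sym.
Qed.

Lemma bop_coord_has_usum (T : bop (ell2 I H)) f i :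
  has_usum (fun j => block T i j (f j)) (T f i).
Proof.
have Tf := has_usum_map (f := T) (bop_norm_le T) (@ell2_has_usum f).
exact: (has_usum_map (f := ell2_coord i) (ell2_coord_bound i) Tf).
Qed.

Lemma hdot_fin_block (T : bop (ell2 I H)) A (v w : I -> H) :
  hdot (T (fin_supp A v)) (fin_supp A w) =
  \sum_(i <- A) \sum_(j <- A) hdot (block T i j (v j)) (w i).
Proof.
rewrite hdot_fin_supp; apply: eq_bigr => i _.
by rewrite /fin_supp linear_sum/= ell2_sumE linear_sumlz.
Qed.

Definition block_form (M : I -> I -> bop H) A (v w : I -> H) : C :=
  \sum_(i <- A) \sum_(j <- A) hdot (M i j (v j)) (w i).

(** Up to the replacement of [v] by [s v] and [w] by [- w / s], this says that
    the finite sections of [M] have norm at most [c]. The present form involves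
    squared norms only, so that bounds of this kind can be added up. *)
Definition quad_bounded (M : I -> I -> bop H) (c : C) :=
  forall A v w, - (block_form M A v w + (block_form M A v w)^*) <=
    c * (\sum_(i <- A) `|v i| ^+ 2 + \sum_(i <- A) `|w i| ^+ 2).

(** The quadratic bound at [w = - c^-1 M v] on [A], the vector for which it is
    the sharpest. *)
Lemma quad_bounded_columns (M : I -> I -> bop H) (c : C) : 0 < c ->
  quad_bounded M c -> forall A B v,
  \sum_(i <- A) `|\sum_(j <- B) M i j (v j)| ^+ 2 <=
    c ^+ 2 * \sum_(j <- B) `|v j| ^+ 2.
Proof.
move=> c0 Mc A B v; set N := \sum_(i <- A) _; set P := \sum_(j <- B) _.
pose y i := \sum_(j <- B) M i j (v j).
pose D := (A `|` B)%fset.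
pose v' j := if j \in B then v j else 0.
pose w' i := if i \in A then - c^-1 *: y i else 0.
have AD : (A `<=` D)%fset by exact: fsubsetUl.
have BD : (B `<=` D)%fset by exact: fsubsetUr.
have := Mc D v' w'.
have -> : block_form M D v' w' = - (c^-1 * N).
  rewrite /block_form /N mulr_sumr -sumrN.
  under eq_bigr => i _.
    rewrite -linear_sumlz/=.
    have -> : \sum_(j <- D) M i j (v' j) = y i.
      rewrite /y -(sum_fset_if _ BD); apply: eq_bigr => j _.
      by rewrite /v'; case: ifP => // _; rewrite linear0.
    over.
  rewrite -(sum_fset_if _ AD); apply: eq_bigr => i _; rewrite /w'.
  case: ifP => _; last by rewrite linear0r.
  rewrite linearZr_LR/= rmorphN/= geC0_conj ?invr_ge0 ?(ltW c0)// mulNr.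
  by rewrite hdot_norm.
have -> : \sum_(i <- D) `|v' i| ^+ 2 = P.
  rewrite /P -(sum_fset_if _ BD); apply: eq_bigr => i _; rewrite /v'.
  by case: ifP => // _; rewrite normr0 expr0n.
have -> : \sum_(i <- D) `|w' i| ^+ 2 = c^-1 ^+ 2 * N.
  rewrite /N mulr_sumr -(sum_fset_if _ AD); apply: eq_bigr => i _; rewrite /w'.
  case: ifP => _; last by rewrite normr0 expr0n.
  by rewrite normrZ normrN exprMn ger0_norm ?invr_ge0 ?(ltW c0).
have N0 : 0 <= N by apply: sumr_ge0 => i _; rewrite exprn_ge0.
rewrite rmorphN rmorphM/= (geC0_conj N0) geC0_conj ?invr_ge0 ?(ltW c0)//.
rewrite -(ler_pM2l c0) -subr_ge0 [X in 0 <= X](_ : _ = c ^+ 2 * P - N) ?subr_ge0//.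
by field; rewrite gt_eqF.
Qed.

(** The operator maps [f] to the unordered sum over [j] of the columns
    [(M i j (f j))_i]. These columns need not be absolutely summable, but they
    are dominated by the square-summable family [|f j|^2]. *)
Lemma quad_bounded_operator (M : I -> I -> bop H) (c : C) : 0 < c ->
  quad_bounded M c ->
  exists T : bop (ell2 I H), (forall i j, block T i j = M i j) /\ `|T| <= c.
Proof.
move=> c0 Mc; have col := quad_bounded_columns c0 Mc.
have colP j u : (fun i => M i j u) \in @ell2_pred R I H.
  apply/asboolP; exists (c ^+ 2 * `|u| ^+ 2) => A.
  by have := col A [fset j]%fset (fun=> u); rewrite big_seq_fset1;
    under eq_bigr do rewrite big_seq_fset1.
pose F (f : I -> H) j : ell2 I H := Ell2 (colP j (f j)).
have Fle (f : I -> H) B : `|\sum_(j <- B) F f j| ^+ 2 <= c ^+ 2 * \sum_(j <- B) `|f j| ^+ 2.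
  rewrite ell2_normE; apply: ell2_dot_le => A.
  by under eq_bigr do rewrite ell2_sumE; exact: col.
have Fcvg f : cvg (psum (F f) @ @fset_filter I).
  have [N fN] := ell2_bound f.
  apply: (@square_dominated_cvg _ _ _ _ (fun i => `|f i| ^+ 2) (c ^+ 2) N) => //.
    by rewrite exprn_ge0// ltW.
  by move=> i; rewrite exprn_ge0.
pose T f := usum (F f).
have TP f : has_usum (F f) (T f) by exact: Fcvg.
have Tlin : linear T.
  move=> a f g; apply: (has_usum_unique (TP _)).
  apply: (has_usum_ext _ (has_usumD (has_usumZ (TP f)) (TP g))) => j.
  by apply: ell2P => i; rewrite ell2D ell2Z /= linearP.
have TB f : `|T f| <= c * `|f|.
  apply: (has_usum_norm_le (TP f)) => A.
  rewrite -(@ler_pXn2r _ 2)// ?nnegrE ?mulr_ge0 ?(ltW c0)//.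
  rewrite (le_trans (Fle f A))// exprMn ler_wpM2l ?exprn_ge0 ?(ltW c0)//.
  exact: ell2_psum_le.
have Tp : T \in @bop_pred R (ell2 I H) by apply/asboolP; split => //; exists c.
exists (Bop Tp); split; last by apply: opnorm_le; [exact: ltW|exact: TB].
move=> i j; apply: bopP => u /=.
suff -> : T (tensor u (delta j)) = F (fun=> u) j by [].
apply: (has_usum_unique (TP _)).
have := @has_usum_finite R I (ell2 I H) (F (tensor u (delta j))) [fset j]%fset.
rewrite big_seq_fset1 [X in has_usum _ X](_ : _ = F (fun=> u) j); last first.
  by apply: ell2P => k /=; rewrite eqxx scale1r.
apply => k; rewrite !inE => kj; apply: ell2P => l.
by rewrite /= (negbTE kj) scale0r linear0.
Qed.

Lemma block_operatorP (M : I -> I -> bop H) (T : bop (ell2 I H)) :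
  (forall i j, block T i j = M i j) -> block_operator M = T.
Proof.
move=> TM; rewrite /block_operator; apply: xget_subset1 => //.
by move=> S S' SM S'M; apply: block_inj => i j; rewrite SM S'M.
Qed.

Lemma block_norm (T : bop (ell2 I H)) i j : `|block T i j| <= `|T|.
Proof.
apply: opnorm_le => // u; rewrite (le_trans (ell2_coord_le _ _))//.
rewrite (le_trans (bop_norm_le _ _))// ler_wpM2l//.
rewrite -(@ler_pXn2r _ 2)// ?nnegrE//.
have := norm_fin_supp [fset j]%fset (fun=> u).
by rewrite /fin_supp !big_seq_fset1 => ->.
Qed.

Lemma blockP (a : C) (S T : bop (ell2 I H)) i j :
  block (a *: S + T) i j = a *: block S i j + block T i j.
Proof. by apply: bopP. Qed.

Lemma block_add (S T : bop (ell2 I H)) i j :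
  block (S + T) i j = block S i j + block T i j.
Proof. by apply: bopP. Qed.

Lemma block_scale (a : C) (T : bop (ell2 I H)) i j :
  block (a *: T) i j = a *: block T i j.
Proof. by apply: bopP. Qed.

Lemma block_sum (J : Type) (r : seq J) (P : pred J) (F : J -> bop (ell2 I H)) i j :
  block (\sum_(k <- r | P k) F k) i j = \sum_(k <- r | P k) block (F k) i j.
Proof.
by apply: bopP => u; rewrite bop_sumE /= bop_sumE ell2_sumE.
Qed.

Lemma block1 i j : block (1 : bop (ell2 I H)) i j = if i == j then 1 else 0.
Proof.
apply: bopP => u /=; case: eqP => _; first by rewrite scale1r.
by rewrite scale0r.
Qed.

Lemma block_adjoint (S T : bop (ell2 I H)) i j :
  is_adjoint S T -> is_adjoint (block S i j) (block T j i).
Proof.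
move=> ST u v; rewrite -[LHS]hdot_tensor_delta ST.
by rewrite [LHS]hdot_conj hdot_tensor_delta -hdot_conj.
Qed.

End block_criterion.

(** * Positive operators and their square roots *)

Section finite_blocks.
Context (R : realType) (H : hilbertType R) (J : finType).
Local Notation C := R[i].

(** Positivity of a finite block matrix, with an arbitrary finite index type
    in order to accommodate products and sums of index sets. *)
Definition positive_kernel (K : J -> J -> bop H) :=
  forall v : J -> H, 0 <= \sum_p \sum_q hdot (K p q (v q)) (v p).

Lemma big_fset_full (V : nmodType) (F : J -> V) :
  \sum_(i <- [fset x | x in J]%fset) F i = \sum_i F i.
Proof.
rewrite -big_enum/=; apply/perm_big/uniq_perm; rewrite ?fset_uniq ?enum_uniq//.
by move=> i; rewrite mem_enum; rewrite in_imfset.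
Qed.

Lemma fin_supp_full (f : ell2 J H) : fin_supp [fset x | x in J]%fset f = f.
Proof. by apply: ell2P => i; rewrite fin_suppE in_imfset. Qed.

Lemma hdot_block (T : bop (ell2 J H)) (f g : ell2 J H) :
  hdot (T f) g = \sum_p \sum_q hdot (block T p q (f q)) (g p).
Proof.
rewrite -{1}(fin_supp_full f) -{1}(fin_supp_full g) hdot_fin_block big_fset_full.
by apply: eq_bigr => p _; rewrite big_fset_full.
Qed.

(** The sum of the norms of all the entries is a crude but sufficient bound. *)
Lemma finite_operator (K : J -> J -> bop H) :
  exists T : bop (ell2 J H), forall p q, block T p q = K p q.
Proof.
pose c := 1 + \sum_p \sum_q `|K p q|.
have c0 : 0 < c by rewrite ltr_pwDl// sumr_ge0// => p _; rewrite sumr_ge0.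
have [|T [TK _]] := @quad_bounded_operator R J H K c c0; last by exists T.
move=> A v w; set a := \sum_(i <- A) _; set b := \sum_(i <- A) _.
have le_sum (u : J -> H) i : i \in A -> `|u i| ^+ 2 <= \sum_(i <- A) `|u i| ^+ 2.
  move=> iA; rewrite (big_fsetD1 i iA)/= lerDl sumr_ge0// => k _.
  by rewrite exprn_ge0.
have ab0 : 0 <= a + b by rewrite addr_ge0// sumr_ge0// => i _; rewrite exprn_ge0.
apply: (@le_trans _ _ ((\sum_(p <- A) \sum_(q <- A) `|K p q|) * (a + b))).
  rewrite /block_form rmorph_sum -big_split -sumrN mulr_suml.
  rewrite big_seq [leRHS]big_seq ler_sum// => p pA.
  rewrite rmorph_sum -big_split -sumrN mulr_suml.
  rewrite big_seq [leRHS]big_seq ler_sum// => q qA.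
  by rewrite (le_trans (hdot_quad_le _ _ (lexx _)))// ler_wpM2l// lerD// le_sum.
rewrite ler_wpM2r//.
have sub (F : J -> C) : (forall j, 0 <= F j) -> \sum_(j <- A) F j <= \sum_j F j.
  move=> F0; rewrite -big_fset_full; apply: psum_le => //.
  by apply/fsubsetP => j _; rewrite in_imfset.
apply: (@le_trans _ _ (\sum_p \sum_q `|K p q|)); last by rewrite lerDr.
apply: (@le_trans _ _ (\sum_p \sum_(q <- A) `|K p q|)).
  by apply: sub => p; rewrite sumr_ge0.
by apply: ler_sum => p _; exact: sub.
Qed.

End finite_blocks.

Section positive_operators.
Context (R : realType) (K : hilbertType R).
Local Notation C := R[i].
Implicit Types (S T : bop K).

Definition positive_operator T := forall f, 0 <= hdot (T f) f.

(** Polarisation: the values at [u + v] and at [u + i v] are real. *)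
Lemma positive_self_adjoint T : positive_operator T -> is_adjoint T T.
Proof.
move=> T0 u v.
set a := hdot (T u) v; rewrite [RHS]hdot_conj; set b := hdot (T v) u.
have real f : hdot (T f) f \is Num.real by rewrite ger0_real.
have ab : a + b \is Num.real.
  have -> : a + b = hdot (T (u + v)) (u + v) - hdot (T u) u - hdot (T v) v.
    by rewrite [T (u + v)]linearD linearDl/= !linearDr/= -/a -/b; ring.
  by rewrite !rpredB.
have iab : 'i * (b - a) \is Num.real.
  have -> : 'i * (b - a) = hdot (T (u + 'i *: v)) (u + 'i *: v) - hdot (T u) u - hdot (T v) v.
    rewrite [T (u + _)]linearD/= [T (_ *: _)]linearZ/= linearDl/= !linearDr/= !linearZl_LR !linearZr_LR/= -/a -/b conjCi.
    rewrite [RHS](_ : _ = 'i * (b - a) - (1 + 'i ^+ 2) * hdot (T v) v); last by ring.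
    by rewrite sqrCi subrr mul0r subr0.
  by rewrite !rpredB.
move: ab iab; rewrite !CrealE rmorphD/= rmorphM/= conjCi rmorphB/= => /eqP e1.
rewrite mulNr -mulrN => /eqP/(mulfI (neq0Ci C)) e2.
have n2 : 2%:R != 0 :> C by rewrite pnatr_eq0.
apply: (mulIf n2).
have -> : b^* * 2%:R = (a^* + b^*) - - (b^* - a^*) by ring.
by rewrite e1 e2; ring.
Qed.

(** Positivity at [u - c^-1 T u] gives
    [2 c^-1 |T u|^2 <= (T u, u) + c^-2 (T (T u), T u)], and the right-hand side
    is at most [c |u|^2 + c^-1 |T u|^2]. *)
Lemma positive_norm_le T (c : C) : 0 < c ->
  (forall f, 0 <= hdot (T f) f <= c * `|f| ^+ 2) -> `|T| <= c.
Proof.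
move=> c0 Tc; have T0 : positive_operator T by move=> f; have /andP[] := Tc f.
have Ts := positive_self_adjoint T0.
apply: opnorm_le => [|u]; first exact: ltW.
rewrite -(@ler_pXn2r _ 2)// ?nnegrE ?mulr_ge0 ?(ltW c0)// exprMn.
set y := T u; have := T0 (u - c^-1 *: y).
rewrite [T (u - _)]linearB/= [T (_ *: _)]linearZ/= linearBl/= !linearBr/= !linearZl_LR !linearZr_LR/=.
rewrite [hdot (T y) u]Ts -/y -hdot_norm geC0_conj ?invr_ge0 ?(ltW c0)//.
have /andP[_ yc] := Tc y; have /andP[_ uc] := Tc u; rewrite -/y in uc.
move=> h; have {}h : 0 <= c * `|u| ^+ 2 - c^-1 * `|y| ^+ 2 - (c^-1 * `|y| ^+ 2 - c^-1 * (c^-1 * (c * `|y| ^+ 2))).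
  apply: (le_trans h); rewrite lerB//.
    by rewrite lerD2r.
  by rewrite lerD2l lerN2 !ler_wpM2l// invr_ge0 ltW.
rewrite -subr_ge0 -(pmulr_rge0 _ (_ : 0 < c^-1)) ?invr_gt0//.
rewrite [X in 0 <= X](_ : _ = c * `|u| ^+ 2 - c^-1 * `|y| ^+ 2 - (c^-1 * `|y| ^+ 2 - c^-1 * (c^-1 * (c * `|y| ^+ 2))))//.
by field; rewrite gt_eqF.
Qed.

Lemma pos_expr_small (q e : C) : 0 <= q < 1 -> 0 < e -> exists n, q ^+ n < e.
Proof.
move=> /andP[q0 q1] e0.
have qE : ((complex.Re q)%:C)%C = q by rewrite RRe_real// ger0_real.
have eE : ((complex.Re e)%:C)%C = e by rewrite RRe_real// gtr0_real.
have q0' : 0 <= complex.Re q by rewrite -lecR qE.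
have q1' : `|complex.Re q| < 1 by rewrite ger0_norm// -ltcR qE.
have /cvgrPdist_lt /(_ (complex.Re e)) h := @cvg_expr R _ q1'.
have [|n _ /(_ n (leqnn n)) /=] := h; first by rewrite -ltcR eE.
rewrite sub0r normrN ger0_norm ?exprn_ge0// -ltcR rmorphXn/= qE eE => qn.
by exists n.
Qed.

(** Write [Y + e = m (1 - x)] with [|x| <= q < 1]. The map
    [z |-> (x + z^2) / 2] sends the ball of radius [q] to itself and is a
    [q]-contraction there, and its fixed point [s] satisfies
    [(1 - s)^2 = 1 - x]. The iterates stay in every norm closed unital algebra
    [D] that contains [Y]; the strict positivity [e > 0] is what makes [q] less
    than [1]. *)
Lemma positive_sqrt (D : set (bop K)) (Y : bop K) (e : C) :
  D 1 -> (forall (a : C) S T, D S -> D T -> D (a *: S + T)) ->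
  (forall S T, D S -> D T -> D (S * T)) ->
  (forall T, (forall d : C, 0 < d -> exists2 S, D S & `|T - S| <= d) -> D T) ->
  D Y -> positive_operator Y -> 0 < e ->
  exists s, exists m : C, [/\ 0 < m, is_adjoint s s, D s & m *: (s * s) = Y + e *: (1 : bop K)].
Proof.
move=> D1 DL DM Dcl DY Y0 e0.
have Ysa := positive_self_adjoint Y0.
(* the summand 1 keeps [q] positive even when [Y = 0] *)
pose m := `|Y| + e + 1; have m0 : 0 < m by rewrite addr_gt0// ltr_wpDl.
pose q := 1 - e / m.
have q0 : 0 < q by rewrite subr_gt0 ltr_pdivrMr// mul1r /m -addrA ltr_wpDl// ltrDl.
have q1 : q < 1 by rewrite /q ltrBlDr ltrDl divr_gt0.
pose x : bop K := 1 - m^-1 *: (Y + e *: (1 : bop K)).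
have xE f : x f = f - m^-1 *: (Y f + e *: f) by [].
have xsa : is_adjoint x x.
  move=> u v; rewrite !xE linearBl/= linearBr/= !linearZl_LR !linearZr_LR/= linearDl/= linearDr/=.
  rewrite !linearZl_LR !linearZr_LR/= Ysa !geC0_conj ?invr_ge0 ?(ltW m0)// ltW//.
have xq : `|x| <= q.
  apply: positive_norm_le => // f.
  have -> : hdot (x f) f = `|f| ^+ 2 - m^-1 * (hdot (Y f) f + e * `|f| ^+ 2).
    rewrite xE linearBl/= !linearZl_LR/= linearDl/=.
    by rewrite !linearZl_LR/= hdot_norm.
  have Yf : hdot (Y f) f <= `|Y| * `|f| ^+ 2.
    rewrite -[leLHS]ger0_norm// (le_trans (hdot_le _ _))// expr2 mulrA ler_wpM2r//.
    exact: bop_norm_le.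
  have f0 : 0 <= `|f| ^+ 2 by rewrite exprn_ge0.
  apply/andP; split.
    rewrite subr_ge0 ler_pdivrMl// mulrDl mul1r (@le_trans _ _ ((`|Y| + e) * `|f| ^+ 2))//.
      by rewrite mulrDl lerD2r.
    by rewrite lerDl.
  rewrite /q mulrBl mul1r lerD2l lerN2 mulrAC mulrC ler_wpM2l ?invr_ge0 ?(ltW m0)//.
  by rewrite lerDr.
pose step z := 2^-1 *: (x + z * z).
pose z n := iter n step 0.
have zq n : `|z n| <= q.
  elim: n => [|n IH]; first by rewrite normr0 ltW.
  rewrite /z iterS -/(z n) /step normrZ ger0_norm ?invr_ge0 ?ler0n//.
  rewrite ler_pdivrMl ?ltr0n// mulr_natl mulr2n.
  rewrite (le_trans (ler_normD _ _))// lerD// (le_trans (bop_normM _ _))//.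
  rewrite (@le_trans _ _ (1 * q))// ?mul1r// -[leRHS]mul1r ler_pM//.
  by rewrite (le_trans IH)// ltW.
have contr S T : `|S| <= q -> `|T| <= q -> `|step S - step T| <= q * `|S - T|.
  move=> Sq Tq; rewrite /step -scalerBr normrZ ger0_norm ?invr_ge0 ?ler0n//.
  rewrite ler_pdivrMl ?ltr0n// opprD addrACA subrr add0r.
  have -> : S * S - T * T = S * (S - T) + (S - T) * T.
    by rewrite mulrBr mulrBl addrA subrK.
  rewrite mulr_natl mulr2n (le_trans (ler_normD _ _))// lerD//.
    by rewrite (le_trans (bop_normM _ _))// ler_wpM2r.
  by rewrite (le_trans (bop_normM _ _))// mulrC ler_wpM2r.
have zC n k : `|z (n + k)%N - z n| <= q ^+ n.
  elim: n => [|n IH]; first by rewrite add0n subr0 expr0 (le_trans (zq k))// ltW.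
  rewrite addSn /z !iterS -/(z _) -/(z n) exprS (le_trans (contr _ _ _ _))//.
  by rewrite ler_wpM2l// ltW.
have /cvg_ex[/= s sz] : cvg (z @ \oo).
  apply: cauchy_cvg; apply/cauchy_ballP => d d0.
  have [|n qn] := @pos_expr_small q (d / 2%:R) _ (divr_gt0 d0 (ltr0n _ 2)).
    by rewrite ltW.
  pose N := [set z (n + k)%N | k in [set: nat]].
  exists (N, N) => /=.
    have : \forall k \near \oo, N (z k).
      by exists n => // k /= nk; exists (k - n)%N => //; rewrite subnKC.
    by split.
  move=> [_ _] /= [[k _ <-] [l _ <-]]; rewrite -ball_normE /=.
  rewrite (le_lt_trans (ler_distD (z n) _ _))// [ltRHS]splitr ltrD//.
    by rewrite (le_lt_trans (zC n k)).
  by rewrite distrC (le_lt_trans (zC n l)).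
have sE : s = 2^-1 *: (x + s * s).
  have zS : z (n + 1)%N @[n --> \oo] --> s by rewrite (@cvg_shiftn 1%N _ z).
  apply: (@cvg_unique _ (@norm_hausdorff _ (bop K)) _ _ _ _ zS).
  have cx : (fun=> x) @ \oo --> x by exact: cvg_cst.
  have -> : (fun n => z (n + 1)%N) = (fun n => 2^-1 *: (x + z n * z n)).
    by apply: funext => n; rewrite addn1 /z iterS.
  exact: cvgZl_tmp (cvgD cx (bop_mul_cvg sz sz)).
have D0 : D 0 by have := DL (-1) _ _ D1 D1; rewrite scaleN1r addNr.
have DZ a T : D T -> D (a *: T) by move=> DT; have := DL a _ _ DT D0; rewrite addr0.
have DD S T : D S -> D T -> D (S + T).
  by move=> DS DT; have := DL 1 _ _ DS DT; rewrite scale1r.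
have Dx : D x by rewrite /x addrC -scaleNr; apply: DL => //; apply/DD/DZ.
have Dz n : D (z n).
  by elim: n => [//|n IH]; rewrite /z iterS; apply/DZ/DD/DM.
have Ds : D s.
  apply: Dcl => d d0; move/cvgrPdist_le : sz => /(_ d d0)[n _ /(_ n (leqnn n)) /= zn].
  by exists (z n).
have zsa n : is_adjoint (z n) (z n).
  elim: n => [|n IH] u v; first by rewrite /= linear0l linear0r.
  rewrite /z iterS -/(z n) -[step _ u]/(2^-1 *: (x u + z n (z n u))).
  rewrite -[step _ v]/(2^-1 *: (x v + z n (z n v))) linearZl_LR linearZr_LR/=.
  by rewrite linearDl/= linearDr/= xsa !IH geC0_conj// invr_ge0 ler0n.
have ssa : is_adjoint s s.
  move=> u v; have cu : (fun=> u) @ \oo --> u by exact: cvg_cst.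
  have cv : (fun=> v) @ \oo --> v by exact: cvg_cst.
  have h1 : (fun n => hdot (z n u) v : complex_line R) @ \oo --> (hdot (s u) v : complex_line R).
    by apply: hdot_cvg cv; exact: bop_app_cvg.
  have h2 : (fun n => hdot (z n u) v : complex_line R) @ \oo --> (hdot u (s v) : complex_line R).
    under eq_fun do rewrite zsa.
    by apply: hdot_cvg cu _; exact: bop_app_cvg.
  exact: (@cvg_unique (complex_line R) (@norm_hausdorff _ _) _ _ _ _ h1 h2).
exists (1 - s), m; split => //.
- move=> u v; rewrite -[(1 - s : bop K) u]/(u - s u) -[(1 - s : bop K) v]/(v - s v).
  by rewrite linearBl/= linearBr/= ssa.
- by rewrite addrC -scaleN1r; exact: DL.
have xs : x = s + s - s * s.
  apply/eqP; rewrite eq_sym subr_eq eq_sym; apply/eqP.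
  by rewrite -[s + s]/(s *+ 2) -scaler_nat {3}sE scalerA mulfV ?scale1r// pnatr_eq0.
have -> : (1 - s) * (1 - s) = 1 - x.
  by rewrite xs mulrBr mulr1 mulrBl mul1r !opprD !opprK !addrA.
rewrite /x opprB addrC subrK scalerA mulfV ?scale1r//.
by rewrite gt_eqF.
Qed.

End positive_operators.

(** * Complete positivity of automorphisms *)

Section kernels.
Context (R : realType) (H : hilbertType R).
Local Notation C := R[i].

Lemma positive_kernel_operator (J : finType) (T : bop (ell2 J H)) :
  positive_kernel (block T) <-> positive_operator T.
Proof.
split=> T0; last first.
  move=> v; have := T0 (fin_supp [fset x | x in J]%fset v).
  rewrite hdot_fin_block big_fset_full.
  by under eq_bigr do rewrite big_fset_full.
by move=> f; rewrite hdot_block; exact: T0.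
Qed.

Lemma positive_kernel_ext (J : finType) (K K' : J -> J -> bop H) :
  (forall p q, K p q = K' p q) -> positive_kernel K -> positive_kernel K'.
Proof.
move=> KK' K0 v; have := K0 v.
by under eq_bigr do under eq_bigr do rewrite KK'.
Qed.

Lemma positive_kernel_adjoint (J : finType) (K : J -> J -> bop H) p q :
  positive_kernel K -> is_adjoint (K p q) (K q p).
Proof.
have [T TK] := finite_operator K; move=> K0.
have T0 : positive_operator T.
  by apply/positive_kernel_operator; apply: positive_kernel_ext K0.
by rewrite -!TK; apply: block_adjoint; exact: positive_self_adjoint.
Qed.

(** Complete positivity transported from matrices indexed by ordinals to
    kernels on a finite type, along an enumeration. *)
Lemma cp_positive_kernel (L : hilbertType R) (phi : bop H -> bop L) (J : finType) (K : J -> J -> bop H) :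
  completely_positive phi -> positive_kernel K ->
  forall v : J -> L, 0 <= \sum_p \sum_q hdot (phi (K p q) (v q)) (v p).
Proof.
move=> [_ phicp] K0 v.
pose x : 'M[bop H]_#|J| := \matrix_(i, j) K (enum_val i) (enum_val j).
have x0 : positive_mx x.
  move=> w; have := K0 (fun p => w (enum_rank p)).
  rewrite (reindex (@enum_val J J)) /=; last first.
    by exists enum_rank => ? _; rewrite ?enum_valK ?enum_rankK.
  under eq_bigr => i _.
    rewrite (reindex (@enum_val J J)) /=; last first.
      by exists enum_rank => ? _; rewrite ?enum_valK ?enum_rankK.
    under eq_bigr => j _ do rewrite !enum_valK.
    over.
  rewrite (eq_bigr (fun i => \sum_j hdot (x i j (w j)) (w i)))// => i _.
  by apply: eq_bigr => j _; rewrite mxE.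
have := phicp _ _ x0 (fun i => v (enum_val i)).
rewrite (reindex (@enum_val J J)) /=; last first.
  by exists enum_rank => ? _; rewrite ?enum_valK ?enum_rankK.
rewrite (eq_bigr (fun i => \sum_q hdot (phi (K (enum_val i) q) (v q)) (v (enum_val i))))// => i _.
rewrite [RHS](reindex (@enum_val J J)) /=; last first.
  by exists enum_rank => ? _; rewrite ?enum_valK ?enum_rankK.
by apply: eq_bigr => j _; rewrite !mxE.
Qed.

Section von_neumann.
Variables (A : set (bop H)) (vA : von_neumann_algebra A).

Lemma vn1 : A 1. Proof. by case: vA. Qed.
Lemma vnP (a : C) x y : A x -> A y -> A (a *: x + y).
Proof. by case: vA => _ h _ _ _; exact: h. Qed.
Lemma vnM x y : A x -> A y -> A (x * y).
Proof. by case: vA => _ _ h _ _; exact: h. Qed.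
Lemma vn0 : A 0.
Proof. by have := vnP (-1) vn1 vn1; rewrite scaleN1r addNr. Qed.
Lemma vnZ (a : C) x : A x -> A (a *: x).
Proof. by move=> Ax; have := vnP a Ax vn0; rewrite addr0. Qed.
Lemma vnD x y : A x -> A y -> A (x + y).
Proof. by move=> Ax Ay; have := vnP 1 Ax Ay; rewrite scale1r. Qed.
Lemma vn_sum (J : Type) (r : seq J) (F : J -> bop H) :
  (forall j, A (F j)) -> A (\sum_(j <- r) F j).
Proof. by move=> AF; elim/big_rec: _ => [|j x _]; [exact: vn0|exact: vnD]. Qed.

Lemma vn_norm_closed x : (forall d : C, 0 < d -> exists2 y, A y & `|x - y| <= d) -> A x.
Proof.
move=> xA; case: vA => _ _ _ _; apply.
apply: norm_limit_initial_closure xA => -[u v] x0 /=.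
apply: (@lipschitz_cvg _ _ (complex_line R) (fun x : bop H => hdot (x u) v)
  (`|u| * `|v|) _ (nbhs x0) _ id x0 _ (@cvg_id _ _)).
  move=> x1 x2; rewrite -linearBl/= (le_trans (hdot_le _ _))// mulrAC ler_wpM2r// mulrC.
  exact: (bop_norm_le (x1 - x2)).
Qed.

Section automorphism.
Variables (phi : bop H -> bop H) (phiA : star_automorphism A phi).

Lemma star_in x : A x -> A (phi x).
Proof. by case: phiA => -[h _ _] _ _ _; exact: h. Qed.
Lemma starP (a : C) x y : A x -> A y -> phi (a *: x + y) = a *: phi x + phi y.
Proof. by case: phiA => _ h _ _; exact: h. Qed.
Lemma starM x y : A x -> A y -> phi (x * y) = phi x * phi y.
Proof. by case: phiA => _ _ h _; exact: h. Qed.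
Lemma star_adjoint x y : A x -> is_adjoint x y -> is_adjoint (phi x) (phi y).
Proof. by case: phiA => _ _ _; apply. Qed.
Lemma star0 : phi 0 = 0.
Proof.
have := starP (-1) vn1 vn1; rewrite scaleN1r addNr => ->.
by rewrite scaleN1r addNr.
Qed.
Lemma starZ (a : C) x : A x -> phi (a *: x) = a *: phi x.
Proof. by move=> Ax; have := starP a Ax vn0; rewrite star0 !addr0. Qed.
Lemma starD x y : A x -> A y -> phi (x + y) = phi x + phi y.
Proof. by move=> Ax Ay; have := starP 1 Ax Ay; rewrite !scale1r. Qed.
Lemma star_sum (J : Type) (r : seq J) (F : J -> bop H) :
  (forall j, A (F j)) -> phi (\sum_(j <- r) F j) = \sum_(j <- r) phi (F j).
Proof.
move=> AF; elim: r => [|j r IH]; first by rewrite !big_nil star0.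
by rewrite !big_cons starD// ?IH//; exact: vn_sum.
Qed.
Lemma star1 : phi 1 = 1.
Proof.
have [_ _ surj] := let: And4 h _ _ _ := phiA in h.
have [x Ax x1] := surj 1 vn1.
by have := starM vn1 Ax; rewrite mul1r x1 mulr1.
Qed.

(** With [K + e = m s^2] for a self-adjoint block matrix [s] over [A],
    [sum_(p, q) (phi(K_pq) v_q, v_p) + e sum_p |v_p|^2] equals
    [m sum_r |sum_q phi(s_rq) v_q|^2], which is nonnegative; then [e] tends to
    [0]. *)
Lemma star_positive_kernel (J : finType) (K : J -> J -> bop H) :
  (forall p q, A (K p q)) -> positive_kernel K ->
  positive_kernel (fun p q => phi (K p q)).
Proof.
move=> AK K0 v; set X := \sum_p _; pose N := \sum_p `|v p| ^+ 2.
have N0 : 0 <= N by apply: sumr_ge0 => p _; rewrite exprn_ge0.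
suff Xe (e : C) : 0 < e -> 0 <= X + e * N.
  apply: approx_ge0 => e e0; have N1 : 0 < N + 1 by rewrite ltr_wpDl.
  exists (X + (e / (N + 1)) * N); first by rewrite Xe// divr_gt0.
  rewrite opprD addNKr normrN ger0_norm ?mulr_ge0 ?invr_ge0 ?(ltW e0) ?(ltW N1)//.
  by rewrite mulrAC ltr_pdivrMr// ltr_pM2l// ltrDl.
move=> e0; have [Y YK] := finite_operator K.
(* block matrices with entries in [A] *)
pose D := [set T : bop (ell2 J H) | forall p q, A (block T p q)].
have blockM (S T : bop (ell2 J H)) p q :
    block (S * T) p q = \sum_r block S p r * block T r q.
  apply: bopP => u; rewrite bop_sumE /=.
  rewrite -{1}(fin_supp_full (T (tensor u (delta q)))) /fin_supp linear_sum ell2_sumE/=.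
  by rewrite big_fset_full.
have D1 : D 1.
  by move=> p q; rewrite block1; case: ifP => _; [exact: vn1|exact: vn0].
have DL (a : C) S T : D S -> D T -> D (a *: S + T).
  by move=> DS DT p q; rewrite blockP; exact: vnP.
have DM S T : D S -> D T -> D (S * T).
  by move=> DS DT p q; rewrite blockM; apply: vn_sum => r; exact: vnM.
have Dcl T : (forall d : C, 0 < d -> exists2 S, D S & `|T - S| <= d) -> D T.
  move=> DT p q; apply: vn_norm_closed => d /DT[S DS TS]; exists (block S p q) => //.
  have -> : block T p q - block S p q = block (T - S) p q by apply: bopP.
  exact: le_trans (block_norm _ _ _) TS.
have DY : D Y by move=> p q; rewrite YK.
have Y0 : positive_operator Y.
  by apply/positive_kernel_operator; apply: positive_kernel_ext K0.
have [s [m [m0 ssa Ds sE]]] := positive_sqrt D1 DL DM Dcl DY Y0 e0.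
have phiK p q : phi (K p q) + (if p == q then e *: (1 : bop H) else 0) =
    m *: \sum_r phi (block s p r) * phi (block s r q).
  have /(congr1 (fun T => phi (block T p q))) := sE.
  rewrite block_scale block_add YK block_scale block1 blockM starZ; last first.
    by apply: vn_sum => r; exact: vnM.
  rewrite star_sum; last by move=> r; exact: vnM.
  under eq_bigr do rewrite starM//.
  move=> ->; rewrite starD//; last by case: ifP => _; apply: vnZ; [exact: vn1|exact: vn0].
  case: ifP => _; first by rewrite starZ ?star1//; exact: vn1.
  by rewrite scaler0 star0.
have : 0 <= m * \sum_r `|\sum_q phi (block s r q) (v q)| ^+ 2.
  by rewrite mulr_ge0 ?(ltW m0)// sumr_ge0// => r _; rewrite exprn_ge0.
suff -> : X + e * N = m * \sum_r `|\sum_q phi (block s r q) (v q)| ^+ 2 by [].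
pose Z p q : C := m * \sum_r hdot (phi (block s p r) (phi (block s r q) (v q))) (v p).
have ZE p q : hdot (phi (K p q) (v q)) (v p) + (if p == q then e * `|v p| ^+ 2 else 0) = Z p q.
  have := congr1 (fun T : bop H => hdot (T (v q)) (v p)) (phiK p q).
  rewrite -[(m *: _ : bop H) _]/(m *: ((\sum_r phi (block s p r) * phi (block s r q)) (v q))).
  rewrite linearZl_LR bop_sumE linear_sumlz/= /Z => <-.
  rewrite linearDl/=; congr (_ + _); case: eqP => [<-|_]; last by rewrite linear0l.
  by rewrite -[(_ *: _ : bop H) _]/(e *: v p) linearZl_LR/= hdot_norm.
transitivity (\sum_p \sum_q Z p q).
  rewrite /X /N mulr_sumr -big_split; apply: eq_bigr => p _ /=.
  under [RHS]eq_bigr do rewrite -ZE.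
  rewrite big_split/= -big_mkcond/= [X in _ = _ + X](big_pred1 p)// => q.
rewrite /Z; under eq_bigr do rewrite -mulr_sumr exchange_big/=.
rewrite -mulr_sumr exchange_big/=; congr (_ * _); apply: eq_bigr => r _.
rewrite hdot_norm linear_sumr/=; apply: eq_bigr => p _.
rewrite linear_sumlz/=; apply: eq_bigr => q _.
by rewrite (star_adjoint (Ds p r) (block_adjoint _ _ ssa)).
Qed.

End automorphism.
End von_neumann.
End kernels.

(** * Unital completely positive maps *)

Section positive_maps.
Context (R : realType) (H : hilbertType R).
Local Notation C := R[i].

Definition unital_positive (th : bop H -> bop H) :=
  [/\ linear th, th 1 = 1 &
      forall (J : finType) (K : J -> J -> bop H),
        positive_kernel K -> positive_kernel (fun p q => th (K p q))].

Lemma automorphism_expectation_positive (A : set (bop H)) (phi pi : bop H -> bop H) :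
  von_neumann_algebra A -> star_automorphism A phi ->
  conditional_expectation A pi -> completely_positive pi ->
  unital_positive (fun x => phi (pi x)).
Proof.
move=> vA phiA [[pil piA piid _] _] picp; split.
- by move=> a x y; rewrite pil; apply: (starP phiA); exact: piA.
- by rewrite piid ?(star1 vA phiA)//; exact: vn1 vA.
- move=> J K K0; apply: (star_positive_kernel vA phiA (K := fun p q => pi (K p q))) => [p q|v].
    exact: piA.
  exact: cp_positive_kernel.
Qed.

Variables (th : bop H -> bop H) (thP : unital_positive th).

Lemma up_linear : linear th. Proof. by case: thP. Qed.

Lemma up0 : th 0 = 0.
Proof. by have := up_linear (-1) 0 0; rewrite scaler0 addr0 scaleN1r addNr. Qed.

Lemma upZ (a : C) x : th (a *: x) = a *: th x.
Proof. by have := up_linear a x 0; rewrite up0 !addr0. Qed.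

(** Complete contractivity of [th], in quadratic form: [th] is applied to the
    positive kernel on [J + J] with diagonal blocks [c] and off-diagonal blocks
    [x] and its adjoint, and the result is evaluated at [(w, v)]. The map [e]
    selects a finite square submatrix of [x], possibly after a permutation of
    its rows and columns. *)
Lemma unital_positive_bound (I : choiceType) (J : finType) (x : bop (ell2 I H))
    (e : J -> I) (c : C) : injective e -> 0 < c -> `|x| <= c ->
  forall (v w : J -> H) (z : C),
  z = \sum_p \sum_q hdot (th (block x (e p) (e q)) (v q)) (w p) ->
  - (z + z^*) <= c * (\sum_p `|v p| ^+ 2 + \sum_p `|w p| ^+ 2).
Proof.
move=> e_inj c0 xc v w z zE; have [y xy] := adjoint_exists x.
have [_ th1 th0] := thP.
pose K (p q : J + J) : bop H := match p, q with
  | inl p, inl q | inr p, inr q => if p == q then c *: (1 : bop H) else 0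
  | inl p, inr q => block x (e p) (e q)
  | inr p, inl q => block y (e p) (e q)
  end.
have diag (u : J -> H) : \sum_p \sum_q
    hdot ((if p == q then c *: (1 : bop H) else 0) (u q)) (u p) = c * \sum_p `|u p| ^+ 2.
  rewrite mulr_sumr; apply: eq_bigr => p _.
  rewrite (bigD1 p)//= eqxx -[(_ *: _ : bop H) _]/(c *: u p) linearZl_LR/= hdot_norm.
  by rewrite big1 ?addr0// => q /negbTE; rewrite eq_sym => ->; rewrite linear0l.
have Kpos : positive_kernel K.
  move=> f; pose F (u : J -> H) : ell2 I H := \sum_p tensor (u p) (delta (e p)).
  pose f1 p := f (inl p); pose f2 p := f (inr p).
  have FE u p : F u (e p) = u p.
    rewrite ell2_sumE (bigD1 p)//= eqxx scale1r big1 ?addr0// => q qp.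
    by rewrite (inj_eq e_inj) eq_sym (negbTE qp) scale0r.
  have Fform (T : bop (ell2 I H)) u u' :
      hdot (T (F u)) (F u') = \sum_p \sum_q hdot (block T (e p) (e q) (u q)) (u' p).
    rewrite linear_sumr/=; apply: eq_bigr => p _.
    by rewrite hdot_tensor_delta linear_sum ell2_sumE linear_sumlz.
  have Fnorm u : `|F u| ^+ 2 = \sum_p `|u p| ^+ 2.
    rewrite hdot_norm [X in hdot _ X]/F linear_sumr/=; apply: eq_bigr => p _.
    by rewrite hdot_tensor_delta FE hdot_norm.
  rewrite big_sumType/=; under eq_bigr do rewrite big_sumType/=.
  under [X in _ + X]eq_bigr do rewrite big_sumType/=.
  rewrite !big_split/= -/f1 -/f2 (diag f1) (diag f2) -!Fform -!Fnorm.
  rewrite [hdot (y _) _]hdot_conj -xy.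
  set t := hdot (x _) _; set a := `|_|; set b := `|_|.
  have tle : `|t| <= c * (b * a).
    rewrite (le_trans (hdot_le _ _))// mulrA ler_wpM2r// (le_trans (bop_norm_le _ _))//.
    by rewrite ler_wpM2r.
  have tre : - (t + t^*) <= (c * (b * a)) *+ 2.
    by rewrite opprD -rmorphN (le_trans (add_conj_le _))// normrN ler_wMn2r.
  rewrite [X in 0 <= X](_ : _ = (c * (b * a) *+ 2 + (t + t^*)) + c * (a - b) ^+ 2); last by ring.
  rewrite addr_ge0//; first by move: tre; rewrite -subr_ge0 opprK.
  by rewrite mulr_ge0 ?(ltW c0)// real_exprn_even_ge0// realB// normr_real.
have thK := th0 _ K Kpos.
have := thK (fun s => match s with inl p => w p | inr p => v p end).
rewrite big_sumType/=; under eq_bigr do rewrite big_sumType/=.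
under [X in _ + X]eq_bigr do rewrite big_sumType/=.
have thd (p q : J) : th (if p == q then c *: (1 : bop H) else 0) = if p == q then c *: (1 : bop H) else 0.
  by case: ifP; rewrite ?up0// upZ th1.
under eq_bigr do under eq_bigr do rewrite thd.
under [X in _ + X]eq_bigr do under [X in _ + X]eq_bigr do rewrite thd.
rewrite !big_split/= (diag w) (diag v) -zE.
have -> : \sum_p \sum_q hdot (th (block y (e p) (e q)) (w q)) (v p) = z^*.
  rewrite zE rmorph_sum exchange_big/=; apply: eq_bigr => p _.
  rewrite rmorph_sum; apply: eq_bigr => q _ /=.
  by rewrite hdot_conj -(positive_kernel_adjoint (inl p) (inr q) thK).
move=> h; rewrite -subr_ge0 opprK; move: h.
set a := \sum_p `|w p| ^+ 2; set b := \sum_p `|v p| ^+ 2.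
by rewrite [X in 0 <= X -> _](_ : _ = c * (b + a) + (z + z^*)); last by ring.
Qed.

End positive_maps.

(** * Bounded linear maps on operators *)

Section bounded_maps.
Context (R : realType) (H : hilbertType R).
Local Notation C := R[i].

Lemma bop_scaleE (a : C) (T : bop H) u : (a *: T) u = a *: T u.
Proof. by []. Qed.

Definition bop_entry (u w : H) (T : bop H) : complex_line R := hdot (T u) w.
Fact bop_entry_linear u w : linear (bop_entry u w).
Proof. by move=> a S T; rewrite /bop_entry -linearPl. Qed.
HB.instance Definition _ u w :=
  GRing.isLinear.Build C (bop H) (complex_line R) *:%R (bop_entry u w) (bop_entry_linear u w).

Lemma bop_entry_bound u w T : `|bop_entry u w T| <= `|u| * `|w| * `|T|.
Proof.
rewrite (le_trans (hdot_le _ _))// mulrAC ler_wpM2r// mulrC; exact: bop_norm_le.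
Qed.

Definition bop_sandwich (a b T : bop H) : bop H := a * T * b.
Fact bop_sandwich_linear a b : linear (bop_sandwich a b).
Proof. by move=> c S T; apply: bopP => u; rewrite /= linearP. Qed.
HB.instance Definition _ a b :=
  GRing.isLinear.Build C (bop H) (bop H) *:%R (bop_sandwich a b) (bop_sandwich_linear a b).

Lemma bop_sandwich_bound a b T : `|bop_sandwich a b T| <= `|a| * `|b| * `|T|.
Proof.
by rewrite (le_trans (bop_normM _ _))// mulrAC ler_wpM2r// bop_normM.
Qed.

Definition bop_scaling (T : bop H) (c : complex_line R) : bop H := (c : C) *: T.
Fact bop_scaling_linear T : linear (bop_scaling T).
Proof. by move=> c a b; rewrite /bop_scaling scalerDl scalerA. Qed.
HB.instance Definition _ T :=
  GRing.isLinear.Build C (complex_line R) (bop H) *:%R (bop_scaling T) (bop_scaling_linear T).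

Lemma bop_scaling_bound T c : `|bop_scaling T c| <= `|T| * `|c|.
Proof. by rewrite normrZ mulrC. Qed.

End bounded_maps.

(** * Quadratic bounds *)

Section quadratic_bounds.
Context (R : realType) (H : hilbertType R).
Local Notation C := R[i].

Lemma diagonal_quad_bounded (I : choiceType) (d : I -> bop H) (c : C) :
  (forall i, `|d i| <= c) -> quad_bounded (fun i j => if i == j then d i else 0) c.
Proof.
move=> dc A v w.
have -> : block_form (fun i j => if i == j then d i else 0) A v w =
    \sum_(i <- A) hdot (d i (v i)) (w i).
  rewrite /block_form big_seq [RHS]big_seq; apply: eq_bigr => i iA.
  rewrite (big_fsetD1 i iA)/= eqxx big_seq big1 ?addr0// => j.
  by rewrite !inE eq_sym => /andP[/negbTE -> _]; rewrite linear0l.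
rewrite rmorph_sum -big_split -sumrN -big_split mulr_sumr ler_sum// => i _.
exact: hdot_quad_le.
Qed.

Lemma unital_positive_quad_bounded (th : bop H -> bop H) (I I' : choiceType)
    (e : I' -> I) (x : bop (ell2 I H)) (c : C) :
  unital_positive th -> injective e -> 0 < c -> `|x| <= c ->
  quad_bounded (fun i j => th (block x (e i) (e j))) c.
Proof.
move=> thP e_inj c0 xc A v w.
have fsetE (V : nmodType) (F : I' -> V) : \sum_(i <- A) F i = \sum_(p : A) F (val p).
  exact: big_seq_fsetE.
rewrite !fsetE; apply: (@unital_positive_bound R H th thP I A x (fun p => e (val p))) => //.
  by move=> p q /e_inj/val_inj.
by rewrite /block_form fsetE; apply: eq_bigr => p _; rewrite fsetE.
Qed.

(** A single operator [y] is viewed as a matrix indexed by [unit], to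
    which the bound on the submatrices applies. *)
Lemma unital_positive_norm (th : bop H -> bop H) (y : bop H) (c : C) :
  unital_positive th -> 0 < c -> `|y| <= c -> `|th y| <= c.
Proof.
move=> thP c0 yc.
have [x [xy xc]] := quad_bounded_operator c0
  (diagonal_quad_bounded (d := fun _ : unit => y) (fun _ => yc)).
have [T [TE Tc]] := quad_bounded_operator c0
  (unital_positive_quad_bounded thP (@inj_id unit) c0 xc).
by have := block_norm T tt tt; rewrite TE xy => /le_trans; apply.
Qed.

End quadratic_bounds.

(** * Ultraweakly continuous functionals *)

Section ultraweak.
Context (R : realType) (K : hilbertType R).
Local Notation C := R[i].
Local Notation line := (complex_line R).

Lemma ultraweak_continuous (u v : ell2 nat K) :
  continuous (fun y : bop K => usum (fun n => hdot (y (u n)) (v n) : line)).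
Proof.
pose M := `|u| ^+ 2 + `|v| ^+ 2.
have bd (T : bop K) (D : {fset nat}) : \sum_(n <- D) `|hdot (T (u n)) (v n) : line| <= M * `|T|.
  apply: (@le_trans _ _ (\sum_(n <- D) (`|u n| ^+ 2 + `|v n| ^+ 2) * `|T|)).
    apply: ler_sum => n _; rewrite (le_trans (hdot_le _ _))//.
    apply: (@le_trans _ _ (`|u n| * `|v n| * `|T|)).
      by rewrite mulrAC ler_wpM2r// mulrC; exact: bop_norm_le.
    by rewrite ler_wpM2r// (le_trans _ (mulr_le_sqrD _ _))// mulr2n lerDl mulr_ge0.
  rewrite -mulr_suml big_split/= ler_wpM2r// lerD//; exact: ell2_psum_le.
have summable (T : bop K) : has_usum (fun n => hdot (T (u n)) (v n) : line)
    (usum (fun n => hdot (T (u n)) (v n) : line)).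
  by apply: abs_summable_cvg; exists (M * `|T|) => D; exact: bd.
move=> y0.
apply: (@lipschitz_cvg _ _ line (fun y : bop K => usum (fun n => hdot (y (u n)) (v n) : line))
  M _ (nbhs y0) _ id y0 _ (@cvg_id _ _)) => x y.
have hs := has_usumD (summable x) (has_usumZ (a := -1) (summable y)).
rewrite scaleN1r in hs; apply: (has_usum_norm_le hs) => D.
rewrite (le_trans _ (bd (x - y) D))// (le_trans (ler_norm_sum _ _ _))//.
by apply: ler_sum => n _; rewrite scaleN1r -linearBl.
Qed.

End ultraweak.

(** * The twisted sums that define the entries *)

Section twisted.
Context (R : realType) (H : hilbertType R) (G : groupType).
Local Notation C := R[i].
Local Notation line := (complex_line R).
Variables (th : G -> bop H -> bop H) (thP : forall g, unital_positive (th g)).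
Implicit Types (xi eta : ell2 G line) (x : bop (ell2 G H)).

(** The two occurrences of the vector in the definition of [sigma] are made
    independent: the approximation by truncation compares [sigma] at two
    vectors by sesquilinearity. *)
Definition twisted_term xi eta x (i j h : G) : bop H :=
  let g := (i * j^-1 * h)%g in
  ((xi g : C)^* * eta h) *: th (j^-1 * h)%g (block x g h).

Lemma translate_sum_mul (f : ell2 G line) (j : G) (A : {fset G}) :
  \sum_(t <- A) `|f (j * t)%g| ^+ 2 <= `|f| ^+ 2.
Proof. by have := translate_sum j^-1%g f A; rewrite invgK. Qed.


Lemma twisted_abs_summable xi eta x i j : abs_summable (twisted_term xi eta x i j).
Proof.
pose c := `|x| + 1; have c0 : 0 < c by rewrite ltr_wpDl.
exists ((`|xi| ^+ 2 + `|eta| ^+ 2) * c) => A.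
apply: (@le_trans _ _ (\sum_(h <- A) (`|xi (i * j^-1 * h)%g| ^+ 2 + `|eta h| ^+ 2) * c)).
  apply: ler_sum => h _; rewrite normrZ ler_pM//.
    rewrite normrM norm_conjC.
    by rewrite (le_trans _ (mulr_le_sqrD _ _))// mulr2n lerDl mulr_ge0.
  apply: unital_positive_norm => //; rewrite (le_trans (block_norm _ _ _))//.
  by rewrite lerDl.
rewrite -mulr_suml big_split/= ler_wpM2r ?(ltW c0)// lerD//.
  exact: translate_sum_mul.
exact: ell2_psum_le.
Qed.

Lemma twisted_has_usum xi eta x i j :
  has_usum (twisted_term xi eta x i j) (usum (twisted_term xi eta x i j)).
Proof. exact: abs_summable_cvg (@twisted_abs_summable xi eta x i j). Qed.

(** In the variable [t = j^-1 h] the map [th t] depends on neither [i] nor [j],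
    so that the positivity of [th t] applies to all the entries at once. *)
Lemma twisted_reindex xi eta x i j :
  has_usum (fun t => ((xi (i * t)%g : C)^* * eta (j * t)%g) *: th t (block x (i * t)%g (j * t)%g))
    (usum (twisted_term xi eta x i j)).
Proof.
have := has_usum_reindex (mulKg j) (mulVKg j) (@twisted_has_usum xi eta x i j).
by apply: has_usum_ext => t /=; rewrite /twisted_term mulKg -mulgA mulKg.
Qed.

Definition twisted_form xi eta x (A : {fset G}) (v w : G -> H) (t : G) : C :=
  block_form (fun i j => th t (block x (i * t)%g (j * t)%g)) A
    (fun j => (eta (j * t)%g : C) *: v j) (fun i => (xi (i * t)%g : C) *: w i).

Lemma has_usum_twisted_form xi eta x A v w :
  has_usum (twisted_form xi eta x A v w : G -> line)
    (block_form (fun i j => usum (twisted_term xi eta x i j)) A v w : line).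
Proof.
apply: has_usum_sum => i _; apply: has_usum_sum => j _.
have := has_usum_map (f := bop_entry (v j) (w i)) (bop_entry_bound (v j) (w i))
  (@twisted_reindex xi eta x i j).
apply: has_usum_ext => t; rewrite /= /bop_entry.
by rewrite bop_scaleE [th t _ (_ *: _)]linearZ/= !linearZl_LR linearZr_LR/= mulrA [_^* * _]mulrC.
Qed.

(** For fixed [t] the bound holds with the vectors [eta (j t) v_j] and
    [xi (i t) w_i]; the sum over [t] of their squared norms is at most
    [|eta|^2 |v|^2] and [|xi|^2 |w|^2]. *)
Lemma twisted_quad_bounded xi eta x (c : C) : `|xi| <= 1 -> `|eta| <= 1 ->
  0 < c -> `|x| <= c ->
  quad_bounded (fun i j => usum (twisted_term xi eta x i j)) c.
Proof.
move=> xi1 eta1 c0 xc A v w.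
set a := \sum_(i <- A) _; set b := \sum_(i <- A) _.
have zs := @has_usum_twisted_form xi eta x A v w.
set z := block_form _ _ _ _ in zs *.
have hs : has_usum (fun t => - (twisted_form xi eta x A v w t + (twisted_form xi eta x A v w t)^*) : line)
    (- (z + z^*) : line).
  have := has_usum_map (f := -%R) (M := 1) _ (has_usumD zs (has_usum_conj zs)).
  by apply => y; rewrite normrN mul1r.
apply: (has_usum_le hs) => D.
have weight (f : ell2 G line) (u : G -> H) : `|f| <= 1 ->
    \sum_(t <- D) \sum_(i <- A) `|(f (i * t)%g : C) *: u i| ^+ 2 <= \sum_(i <- A) `|u i| ^+ 2.
  move=> f1; rewrite exchange_big/= ler_sum// => i _.
  under eq_bigr do rewrite normrZ exprMn.
  rewrite -mulr_suml ler_piMl ?exprn_ge0// (le_trans (translate_sum_mul _ _ _))//.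
  by rewrite exprn_ile1.
apply: (@le_trans _ _ (\sum_(t <- D) c * (\sum_(i <- A) `|(eta (i * t)%g : C) *: v i| ^+ 2
   + \sum_(i <- A) `|(xi (i * t)%g : C) *: w i| ^+ 2))).
  apply: ler_sum => t _.
  exact: (unital_positive_quad_bounded (thP t) (@mulIg _ t) c0 xc).
by rewrite -mulr_sumr ler_wpM2l ?(ltW c0)// big_split lerD// weight.
Qed.

End twisted.

(** * The map sigma *)

Section crossed_expectation.
Context (R : realType) (H : hilbertType R) (G : groupType).
Local Notation C := R[i].
Local Notation line := (complex_line R).
Variables (A : set (bop H)) (alpha : G -> bop H -> bop H) (pi : bop H -> bop H).
Hypotheses (vA : von_neumann_algebra A) (act : is_action A alpha).
Hypotheses (Epi : conditional_expectation A pi) (cppi : completely_positive pi).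

Let th g x := alpha g (pi x).

Let thP g : unital_positive (th g).
Proof. by case: act => aut _ _; exact: automorphism_expectation_positive vA (aut g) Epi cppi. Qed.

Let piA x : A (pi x). Proof. by case: Epi => -[]. Qed.
Let piid x : A x -> pi x = x. Proof. by case: Epi => -[_ _ h _] _; exact: h. Qed.
Let alphaA g x : A x -> A (alpha g x).
Proof. by case: act => aut _ _; exact: star_in (aut g) x. Qed.
Let alphaM g h x : A x -> alpha g (alpha h x) = alpha (g * h)%g x.
Proof. by case: act => _ _ m Ax; rewrite m. Qed.
Let alpha_mul g x y : A x -> A y -> alpha g (x * y) = alpha g x * alpha g y.
Proof. by case: act => aut _ _; exact: (starM (aut g)). Qed.
Let alphath g x : A x -> alpha g x = th g x.
Proof. by move=> Ax; rewrite /th piid. Qed.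

Lemma Psi_exists r : A r -> exists T : bop (ell2 G H),
  forall i j, block T i j = if i == j then alpha i^-1%g r else 0.
Proof.
move=> Ar; have c0 : 0 < `|r| + 1 by rewrite ltr_wpDl.
have bd (i : G) : `|alpha i^-1%g r| <= `|r| + 1.
  by rewrite alphath// unital_positive_norm// lerDl.
by have [T [TE _]] := quad_bounded_operator c0 (diagonal_quad_bounded bd); exists T.
Qed.

Lemma block_Psi r i j : A r ->
  block (Psi alpha r : bop (ell2 G H)) i j = if i == j then alpha i^-1%g r else 0.
Proof. by move=> /Psi_exists[T TE]; rewrite /Psi (block_operatorP TE) TE. Qed.

Lemma PsiE r (f : ell2 G H) i : A r -> Psi alpha r f i = alpha i^-1%g r (f i).
Proof.
move=> Ar; apply: (has_usum_unique (@bop_coord_has_usum _ _ _ _ f i)).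
have := @has_usum_finite R G H (fun j => block (Psi alpha r) i j (f j)) [fset i]%fset.
rewrite big_seq_fset1 [in X in has_usum _ X]block_Psi// eqxx; apply => j.
by rewrite inE eq_sym block_Psi// => /negbTE ->.
Qed.

Lemma block_Psi_mul r (x : bop (ell2 G H)) i j : A r ->
  block (Psi alpha r * x) i j = alpha i^-1%g r * block x i j.
Proof. by move=> Ar; apply: bopP => u; exact: PsiE. Qed.

Lemma block_mul_Psi r (x : bop (ell2 G H)) i j : A r ->
  block (x * Psi alpha r) i j = block x i j * alpha j^-1%g r.
Proof.
move=> Ar; apply: bopP => u /=.
suff -> : Psi alpha r (tensor u (delta j)) = tensor (alpha j^-1%g r u) (delta j) by [].
apply: ell2P => k; rewrite PsiE//=.
by case: eqP => [->|_]; rewrite ?scale1r ?scale0r ?linear0.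
Qed.

Lemma block_translate_mul g (x : bop (ell2 G H)) i j :
  block (translate H g * x) i j = block x (g^-1 * i)%g j.
Proof. by apply: bopP. Qed.

Section sigma.
Variable xi : ell2 G line.
Hypothesis xi1 : `|xi| = 1.

Lemma block_sigma x i j : block (sigma alpha pi xi x) i j = usum (sigma_term alpha pi xi x i j).
Proof.
have c0 : 0 < `|x| + 1 by rewrite ltr_wpDl.
have xi1' : `|xi| <= 1 by rewrite xi1.
have [|T [TE _]] := quad_bounded_operator c0 (twisted_quad_bounded thP xi1' xi1' c0 _ (x := x)).
  by rewrite lerDl.
by rewrite /sigma (block_operatorP TE) TE.
Qed.

Lemma sigma_term_summable x i j : abs_summable (sigma_term alpha pi xi x i j).
Proof. exact: (twisted_abs_summable thP xi xi x i j). Qed.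

Lemma sigma_has_usum x i j :
  has_usum (sigma_term alpha pi xi x i j) (block (sigma alpha pi xi x) i j).
Proof. by rewrite block_sigma; exact: (@twisted_has_usum R H G th thP xi xi x i j). Qed.

(** In the term of index [h], with [g = i j^-1 h], the blocks of [Psi(r)] and
    [Psi(s)] contribute [alpha_(g^-1)(r)] and [alpha_(h^-1)(s)] around
    [x_(g, h)]. They leave [pi] by bimodularity, and [alpha_(j^-1 h)] maps them
    to [alpha_(i^-1)(r)] and [alpha_(j^-1)(s)], which no longer depend on
    [h]. *)
Lemma sigma_bimodular r s x : A r -> A s ->
  sigma alpha pi xi (Psi alpha r * x * Psi alpha s) =
  Psi alpha r * sigma alpha pi xi x * Psi alpha s.
Proof.
move=> Ar As; apply: block_inj => i j.
rewrite block_mul_Psi// block_Psi_mul//.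
have hs := has_usum_map (f := bop_sandwich (alpha i^-1%g r) (alpha j^-1%g s))
  (bop_sandwich_bound _ _) (@sigma_has_usum x i j).
apply: (has_usum_unique (@sigma_has_usum _ i j)).
apply: has_usum_ext hs => h /=; rewrite /sigma_term /bop_sandwich /=.
rewrite block_mul_Psi// block_Psi_mul//.
case: Epi => _ pib; rewrite pib; [|exact: alphaA|exact: alphaA].
rewrite alpha_mul ?alpha_mul//; try exact: alphaA; last by apply: vnM => //; exact: alphaA.
rewrite !alphaM//.
have -> (a b T : bop H) (c : C) : a * (c *: T) * b = c *: (a * T * b).
  by apply: bopP => u; rewrite /= [LHS]linearZ.
congr (_ *: (alpha _ _ * _ * alpha _ _)).
  by rewrite !invgM invgK -!mulgA mulVKg mulKg.
by rewrite -mulgA mulgV mulg1.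
Qed.

(** The block [(a h, h)] of [L_g Psi(r)] is zero unless [a = g], and then it is
    [alpha_(h^-1)(r)], which [alpha_(j^-1 h)] maps to [alpha_(j^-1)(r)] for
    every [h]. Only the sum of the coefficients is left. *)
Lemma sigma_eigen g r : A r ->
  sigma alpha pi xi (translate H g * Psi alpha r) =
  hdot (lambda g xi) xi *: (translate H g * Psi alpha r).
Proof.
move=> Ar; apply: block_inj => i j.
rewrite block_scale block_translate_mul block_Psi//.
apply: (has_usum_unique (@sigma_has_usum _ i j)).
have hs : has_usum (fun h => (xi h : C) * (xi (g * h)%g : C)^* : line) (hdot (lambda g xi) xi : line).
  have := has_usum_reindex (mulKg g) (mulVKg g) (@ell2_dot_cvg R G line (lambda g xi) xi).
  by apply: has_usum_ext => h /=; rewrite mulKg.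
case: ifPn => gij.
  rewrite (eqP gij).
  have := has_usum_map (f := bop_scaling (alpha j^-1%g r)) (bop_scaling_bound _) hs.
  apply: has_usum_ext => h; rewrite /= /bop_scaling /sigma_term.
  have -> : (i * j^-1 * h = g * h)%g by rewrite -(eqP gij) invgM invgK mulgA mulgV mul1g.
  rewrite block_translate_mul block_Psi// mulKg eqxx piid ?alphaM//; last exact: alphaA.
  by rewrite -mulgA mulgV mulg1 mulrC.
rewrite scaler0; apply: has_usum_ext (@has_usum0 R G (bop H)) => h.
rewrite /sigma_term block_translate_mul block_Psi// ifN.
  by rewrite -[alpha _ _]/(th _ 0) (up0 (thP _)) scaler0.
apply: contra gij => /eqP gh; apply/eqP/(mulIg (j^-1 * h)%g).
by rewrite mulVKg -[RHS]gh !mulgA.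
Qed.

Lemma sigma_unital : sigma alpha pi xi 1 = 1.
Proof.
have A1 := vn1 vA.
have e : translate H 1%g * Psi alpha 1 = 1 :> bop (ell2 G H).
  apply: block_inj => i j; rewrite block_translate_mul invg1 mul1g block_Psi// block1.
  by case: ifP => // _; rewrite alphath//; case: (thP i^-1%g) => _ -> _.
have := sigma_eigen 1%g A1; rewrite e => ->.
have -> : lambda 1%g xi = xi by apply: ell2P => h /=; rewrite invg1 mul1g.
by rewrite -hdot_norm xi1 expr1n scale1r.
Qed.

Lemma sigma_linear : linear (sigma alpha pi xi).
Proof.
move=> a x y; apply: block_inj => i j; rewrite blockP.
apply: (has_usum_unique (@sigma_has_usum _ i j)).
have hs := has_usumD (has_usumZ (a := a) (@sigma_has_usum x i j)) (@sigma_has_usum y i j).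
apply: (has_usum_ext _ hs) => h; rewrite /sigma_term blockP.
rewrite -![alpha _ (pi _)]/(th _ _) (up_linear (thP _)) scalerDr.
by rewrite !scalerA [a * _]mulrC.
Qed.

(** Positivity of [th t] on the kernel indexed by pairs made of a row of the
    matrix [X] of operators and of an element of the finite support. *)
Lemma twisted_form_positive n (X : 'M[bop (ell2 G H)]_n) (v : 'I_n -> G -> H)
    (D : {fset G}) t : positive_mx X ->
  0 <= \sum_a \sum_b twisted_form th xi xi (X a b) D (v b) (v a) t.
Proof.
move=> X0; pose J : finType := ('I_n * D)%type.
pose K (p q : J) := block (X p.1 q.1) (val p.2 * t)%g (val q.2 * t)%g.
have pairE (F : J -> C) : \sum_p F p = \sum_a \sum_i F (a, i).
  by rewrite pair_bigA; apply: eq_bigr => -[].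
have Kpos : positive_kernel K.
  move=> f.
  pose W a : ell2 G H := \sum_(i : D) tensor (f (a, i)) (delta (val i * t)%g).
  have := X0 W; congr (0 <= _); rewrite pairE; apply: eq_bigr => a _.
  under [RHS]eq_bigr => i _ do rewrite pairE.
  rewrite [RHS]exchange_big/=; apply: eq_bigr => b _.
  rewrite [X in hdot _ X]/W linear_sumr/=; apply: eq_bigr => i _.
  by rewrite hdot_tensor_delta /W linear_sum ell2_sumE linear_sumlz.
case: (thP t) => _ _ /(_ J K Kpos) /(_ (fun p => (xi (val p.2 * t)%g : C) *: v p.1 (val p.2))).
congr (0 <= _); rewrite pairE; apply: eq_bigr => a _.
under eq_bigr => i _ do rewrite pairE.
rewrite exchange_big/=; apply: eq_bigr => b _.
rewrite /twisted_form /block_form big_seq_fsetE/=; apply: eq_bigr => i _.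
by rewrite big_seq_fsetE.
Qed.

(** On vectors with support in [D] the form is a sum over [t] of nonnegative
    terms; finitely supported vectors are dense. *)
Lemma sigma_completely_positive : completely_positive (sigma alpha pi xi).
Proof.
split; first exact: sigma_linear.
move=> n X X0 v.
pose s D : line := \sum_a \sum_b
  hdot (sigma alpha pi xi (X a b) (fin_supp D (v b))) (fin_supp D (v a)).
have sD : s D @[D --> @fset_filter G] -->
    (\sum_a \sum_b hdot (map_mx (sigma alpha pi xi) X a b (v b)) (v a) : line).
  apply: cvg_big => [|a _]; first exact: add_continuous.
  apply: cvg_big => [|b _]; first exact: add_continuous.
  rewrite mxE; apply: hdot_cvg; last exact: ell2_has_usum.
  by apply: bop_cvg; exact: ell2_has_usum.
apply: (cvg_ge sD); near=> D.
have hs : has_usum (fun t => \sum_a \sum_b twisted_form th xi xi (X a b) D (v b) (v a) t : line) (s D).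
  apply: has_usum_sum => a _; apply: has_usum_sum => b _.
  rewrite hdot_fin_block.
  have := @has_usum_twisted_form R H G th thP xi xi (X a b) D (v b) (v a).
  have -> : block_form (fun i j => usum (twisted_term th xi xi (X a b) i j)) D (v b) (v a) =
    \sum_(i <- D) \sum_(j <- D) hdot (block (sigma alpha pi xi (X a b)) i j (v b j)) (v a i).
    by apply: eq_bigr => i _; apply: eq_bigr => j _; rewrite block_sigma.
  exact.
apply: (has_usum_ge hs) => B; apply: sumr_ge0 => t _.
exact: twisted_form_positive.
Unshelve. all: by end_near. Qed.

Lemma crossed_span_cons (a : C) g r (T : bop (ell2 G H)) :
  A r -> crossed_span A alpha T ->
  crossed_span A alpha (a *: (translate H g * Psi alpha r) + T).
Proof.
move=> Ar [n [c [y [yA ->]]]].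
exists n.+1, (fun i => if unlift ord0 i is Some k then c k else a),
  (fun i => if unlift ord0 i is Some k then y k else translate H g * Psi alpha r).
split; first by move=> i; case: unliftP => [k _|_]; [exact: yA|exists g => //; exists r].
by rewrite big_ord_recl unlift_none; congr (_ + _); apply: eq_bigr => k _; rewrite liftK.
Qed.

Lemma crossed_span_sum (J : Type) (s : seq J) (a : J -> C) (g : J -> G) (r : J -> bop H) :
  (forall j, A (r j)) ->
  crossed_span A alpha (\sum_(j <- s) a j *: (translate H (g j) * Psi alpha (r j))).
Proof.
move=> Ar; elim: s => [|j s IH]; last by rewrite big_cons; exact: crossed_span_cons.
rewrite big_nil; exists 0, (fun _ => 0), (fun _ => 0).
by split; [case|rewrite big_ord0].
Qed.

(** The finite subsum of the series of [sigma x] over pairs in [D]; by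
    [truncated_sigma_block] it is [sigma x] for the vector [xi] cut down to
    [D]. *)
Definition truncated_sigma (x : bop (ell2 G H)) (D : {fset G}) : bop (ell2 G H) :=
  \sum_(p <- [seq (g, h) | g <- D, h <- D])
    ((xi p.1 : C)^* * xi p.2) *:
      (translate H (p.1 * p.2^-1)%g * Psi alpha (th p.2 (block x p.1 p.2))).

Lemma truncated_sigma_span x D : crossed_span A alpha (truncated_sigma x D).
Proof. by apply: crossed_span_sum => p; exact: alphaA. Qed.

Lemma truncated_sigma_block x D i j :
  has_usum (twisted_term th (fin_supp D xi) (fin_supp D xi) x i j)
    (block (truncated_sigma x D) i j).
Proof.
set k := fin_supp D xi.
have kE h : k h = if h \in D then xi h else 0 by exact: fin_suppE.
have := @has_usum_finite R G (bop H) (twisted_term th k k x i j) D.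
suff -> : block (truncated_sigma x D) i j = \sum_(h <- D) twisted_term th k k x i j h.
  by apply=> h /negbTE hD; rewrite /twisted_term (kE h) hD mulr0 scale0r.
rewrite block_sum big_allpairs exchange_big/= big_seq [RHS]big_seq; apply: eq_bigr => h hD.
set g0 := (i * j^-1 * h)%g.
have bE g : block (((xi g : C)^* * xi h) *: (translate H (g * h^-1)%g * Psi alpha (th h (block x g h)))) i j =
    if g == g0 then ((xi g : C)^* * xi h) *: th (j^-1 * h)%g (block x g h) else 0.
  rewrite block_scale block_translate_mul block_Psi; last exact: alphaA.
  case: (eqVneq g g0) => [->|gg0].
    have -> : ((g0 * h^-1)^-1 * i = j)%g.
      by rewrite /g0 -mulgA mulgV mulg1 invgM invgK -mulgA mulVg mulg1.
    by rewrite eqxx alphaM.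
  rewrite ifN ?scaler0//; apply: contraNneq gg0 => e.
  by rewrite /g0 -e invgM invgK mulVKg -mulgA mulVg mulg1.
under eq_bigr do rewrite bE.
rewrite /twisted_term -/g0/= !kE hD.
case: ifPn => g0D.
  rewrite (big_fsetD1 g0 g0D)/= eqxx big_seq big1 ?addr0// => g.
  by rewrite !inE => /andP[/negbTE -> _].
rewrite conjC0 mul0r scale0r big_seq big1// => g gD.
by rewrite ifN//; apply: contraNneq g0D => <-.
Qed.

(** With [k] the truncation of [xi] to [D], split
    [S(xi, xi) = S(xi - k, xi) + S(k, xi - k) + S(k, k)]. The first two terms
    have norm at most [d c] when [|xi - k| <= d], and the last one is
    [truncated_sigma]. *)
Lemma sigma_crossed x : crossed_product A alpha (sigma alpha pi xi x).
Proof.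
apply: norm_limit_initial_closure => [[u v]|e e0].
  exact: ultraweak_continuous.
pose c := `|x| + 1; have c0 : 0 < c by rewrite ltr_wpDl.
have xc : `|x| <= c by rewrite lerDl.
pose d := e / (c + c).
have d0 : 0 < d by rewrite divr_gt0// addr_gt0.
have [D xiD] := ell2_approx xi d0; exists (truncated_sigma x D).
  exact: truncated_sigma_span.
pose k : ell2 G line := fin_supp D xi.
have k1 : `|k| <= 1.
  rewrite -(@ler_pXn2r _ 2)// ?nnegrE// norm_fin_supp (le_trans (ell2_psum_le _ _))//.
  by rewrite xi1.
(* the difference is rescaled to the unit ball, where the bound is available *)
pose z := d^-1 *: (xi - k).
have z1 : `|z| <= 1.
  by rewrite normrZ ger0_norm ?invr_ge0 ?(ltW d0)// ler_pdivrMl// mulr1.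
have xi1' : `|xi| <= 1 by rewrite xi1.
have [T1 [T1E T1c]] := quad_bounded_operator c0 (twisted_quad_bounded thP z1 xi1' c0 xc).
have [T2 [T2E T2c]] := quad_bounded_operator c0 (twisted_quad_bounded thP k1 z1 c0 xc).
have -> : sigma alpha pi xi x = d *: T1 + (d *: T2 + truncated_sigma x D).
  apply: block_inj => i j; rewrite !blockP.
  apply: (has_usum_unique (@sigma_has_usum x i j)).
  have h1 := @twisted_has_usum R H G th thP z xi x i j.
  have h2 := @twisted_has_usum R H G th thP k z x i j.
  rewrite -T1E in h1; rewrite -T2E in h2.
  have hs := has_usumD (has_usumZ (a := d) h1) (has_usumD (has_usumZ (a := d) h2) (@truncated_sigma_block x D i j)).
  apply: (has_usum_ext _ hs) => h; rewrite /sigma_term /twisted_term.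
  rewrite -[alpha _ (pi _)]/(th _ _) !scalerA -!scalerDl; congr (_ *: _).
  rewrite -/k /z !ell2Z !ell2B.
  set g := (i * j^-1 * h)%g.
  have -> : ((d^-1 *: (xi g - k g) : line) : C)^* = d^-1 * ((xi g : C)^* - (k g : C)^*).
    rewrite -[LHS]/((d^-1 * ((xi g : C) - (k g : C)))^*) rmorphM rmorphB/=.
    by rewrite geC0_conj// invr_ge0 ltW.
  rewrite -[(d^-1 *: (xi h - k h) : line)]/(d^-1 * ((xi h : C) - (k h : C)) : C).
  by field; rewrite gt_eqF.
rewrite addrA addrK (le_trans (ler_normD _ _))// !normrZ ger0_norm ?(ltW d0)// -mulrDr.
rewrite (@le_trans _ _ (d * (c + c)))//; last by rewrite divfK// gt_eqF// addr_gt0.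
by rewrite ler_wpM2l ?(ltW d0)// lerD.
Qed.

End sigma.
End crossed_expectation.

Theorem theorem3p1 (R : realType) (H : hilbertType R) (A : set (bop H))
    (G : groupType) (alpha : G -> bop H -> bop H) (pi : bop H -> bop H)
    (xi : ell2 G (complex_line R)) :
  von_neumann_algebra A -> injective_algebra A -> is_action A alpha ->
  conditional_expectation A pi -> completely_positive pi -> `|xi| = 1 ->
  let L := translate H in
  let Psi := Psi alpha in
  let sigma := sigma alpha pi xi in
  (* Psi and sigma are well-defined *)
  (forall r, A r -> forall i j : G,
     block (Psi r) i j = if i == j then alpha i^-1%g r else 0) /\
  (forall x i j, abs_summable (sigma_term alpha pi xi x i j) /\
     has_usum (sigma_term alpha pi xi x i j) (block (sigma x) i j)) /\
  [/\ forall x, crossed_product A alpha (sigma x),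
      sigma 1 = 1,
      completely_positive sigma,
      forall r s x, A r -> A s ->
        sigma (Psi r * x * Psi s) = Psi r * sigma x * Psi s &
      forall (g : G) r, A r ->
        sigma (L g * Psi r) = hdot (lambda g xi) xi *: (L g * Psi r)].
Proof.
move=> vA _ act Epi cppi xi1 L Psi' sigma'.
split; first by move=> r Ar i j; exact: (block_Psi vA act Epi cppi).
split.
  move=> x i j; split; first exact: (sigma_term_summable vA act Epi cppi).
  exact: (@sigma_has_usum R H G A alpha pi vA act Epi cppi xi xi1).
split.
- exact: (sigma_crossed vA act Epi cppi xi1).
- exact: (sigma_unital vA act Epi cppi xi1).
- exact: (sigma_completely_positive vA act Epi cppi xi1).
- exact: (sigma_bimodular vA act Epi cppi xi1).
- exact: (sigma_eigen vA act Epi cppi xi1).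
Qed.
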